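(* Let $\mathcal{H}\subset\mathbb{M}_{M,N}$ be a linear subspace, let $F\in\mathcal{H}$, $\tau>0$ and $1<q<\infty$. For any starting point in $\mathbb{M}_{M,N}$, the Picard iteration $W^{n+1}=\mathfrak{B}_{F,\tau,q}(W^n)$ converges to a fixed point $W^{\circ}$ of $\mathfrak{B}_{F,\tau,q}$. Moreover, $\mathcal{P}_{\mathcal{H}}(W^{\circ})$ is unique (i.e. it is the same for all fixed points), and $$A^{\circ}=\frac{1}{q-1}\left(qF-\mathcal{P}_{\mathcal{H}}(W^{\circ})\right)$$ is the unique solution to $$\operatorname*{arg\,min}_{A\in\mathcal{H}}\ \mathcal{R}_{\tau}(A)+q\|A-F\|^2 .$$
   Context: $\mathbb{M}_{M,N}$ is the Euclidean space of $M\times N$ matrices (real or complex) with the Frobenius norm $\|\cdot\|$; $\sigma_j(A)$ denotes the singular values of $A$. For $\tau>0$, $$\mathcal{R}_{\tau}(A)=\sum_j\left(\tau^2-\big(\max(\tau-\sigma_j(A),0)\big)^2\right).$$ $\mathcal{P}_{\mathcal{H}}$ and $\mathcal{P}_{\mathcal{H}^\perp}$ are the orthogonal projections onto $\mathcal{H}$ and its orthogonal complement. Singular value functional calculus: for a real-valued $f$ on $[0,\infty)$ with $f(0)=0$ and $A=U\,\mathrm{diag}(\{\sigma_j(A)\})V^*$ a singular value decomposition, $\mathfrak{S}_f(A)=U\,\mathrm{diag}(\{f(\sigma_j(A))\})V^*$. Set $s_{\tau,q}(\sigma)=\max\left(\min(\sigma,\tau),\frac{\sigma}{q}\right)$ and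 $$\mathfrak{B}_{F,\tau,q}(W)=\mathfrak{S}_{s_{\tau,q}}\big(qF+\mathcal{P}_{\mathcal{H}^\perp}(W)\big),\qquad W\in\mathbb{M}_{M,N}.$$ *)

(* Defs.v *)
From mathcomp Require Export all_boot all_order all_algebra.
From mathcomp.real_closed Require Export complex.
From mathcomp Require Export all_classical all_reals all_analysis.
Export Order.TTheory GRing.Theory Num.Theory.
Export numFieldNormedType.Exports.

Set Implicit Arguments.
Unset Strict Implicit.
Unset Printing Implicit Defensive.

Global Open Scope classical_set_scope.
Global Open Scope ring_scope.

(* Matrices are real or complex: the scalar field is [R] or [R[i]] according
   to a flag, so that both cases are covered by one statement. *)
Variant scalar_kind := RealScalars | ComplexScalars.

Definition scalars (R : realType) (k : scalar_kind) : numFieldType :=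
  match k with
  | RealScalars => R
  | ComplexScalars => R[i]
  end.

Definition of_real (R : realType) (k : scalar_kind) : R -> scalars R k :=
  match k with
  | RealScalars => fun x => x
  | ComplexScalars => fun x => real_complex R x
  end.
Arguments of_real {R} k x.

Definition re_part (R : realType) (k : scalar_kind) : scalars R k -> R :=
  match k with
  | RealScalars => fun x => x
  | ComplexScalars => fun z => complex.Re z
  end.

Definition conj_scalar (R : realType) (k : scalar_kind) :
    scalars R k -> scalars R k :=
  match k with
  | RealScalars => fun x => x
  | ComplexScalars => fun z => conjc z
  end.
Arguments re_part {R} k x.
Arguments conj_scalar {R} k x.

Section MatrixSpace.
Variables (R : realType) (k : scalar_kind).
Local Notation K := (scalars R k).

Definition adjoint (M N : nat) (A : 'M[K]_(M, N)) : 'M[K]_(N, M) :=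
  (map_mx (conj_scalar k) A)^T.

Definition unitary (M : nat) (U : 'M[K]_M) : Prop :=
  adjoint U *m U = 1%:M.

Definition frob_inner (M N : nat) (A B : 'M[K]_(M, N)) : K :=
  \sum_(i < M) \sum_(j < N) A i j * conj_scalar k (B i j).

(* [frob_inner A A] is real. *)
Definition frob_norm (M N : nat) (A : 'M[K]_(M, N)) : R :=
  Num.sqrt (re_part k (frob_inner A A)).

Definition rect_diag (M N : nat) (s : 'rV[R]_(minn M N)) : 'M[K]_(M, N) :=
  \matrix_(i < M, j < N)
    \sum_(l < minn M N | (l == i :> nat) && (l == j :> nat))
      of_real k (s 0 l).

Definition is_svd (M N : nat) (A : 'M[K]_(M, N))
    (U : 'M[K]_M) (s : 'rV[R]_(minn M N)) (V : 'M[K]_N) : Prop :=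
  [/\ unitary U, unitary V,
      forall l, 0 <= s 0 l,
      forall l m : 'I_(minn M N), (l <= m)%N -> s 0 m <= s 0 l
    & A = U *m rect_diag s *m adjoint V].

(* The vector of singular values is determined by [A], and [sv_calculus]
   below does not depend on the decomposition (as [f 0 = 0]), so the choices
   made by [xget] are harmless; the default 0 is never used. *)
Definition singular_values (M N : nat) (A : 'M[K]_(M, N)) :
    'rV[R]_(minn M N) :=
  xget 0 [set s | exists U V, is_svd A U s V].

Definition sv_calculus (f : R -> R) (M N : nat) (A : 'M[K]_(M, N)) :
    'M[K]_(M, N) :=
  xget 0 [set B | exists U V, is_svd A U (singular_values A) V /\
    B = U *m rect_diag (map_mx f (singular_values A)) *m adjoint V].

Definition orth_compl (M N : nat) (E : set 'M[K]_(M, N)) :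
    set 'M[K]_(M, N) :=
  [set X | forall Y, E Y -> frob_inner X Y = 0].

(* For a linear subspace [E] there is exactly one such [Y]. *)
Definition orth_proj (M N : nat) (E : set 'M[K]_(M, N))
    (X : 'M[K]_(M, N)) : 'M[K]_(M, N) :=
  xget 0 [set Y | E Y /\ orth_compl E (X - Y)].

Definition R_tau (tau : R) (M N : nat) (A : 'M[K]_(M, N)) : R :=
  \sum_(j < minn M N)
    (tau ^+ 2 - (Num.max (tau - singular_values A 0 j) 0) ^+ 2).

Definition s_fun (tau q sigma : R) : R :=
  Num.max (Num.min sigma tau) (sigma / q).

Definition B_op (M N : nat) (H : set 'M[K]_(M, N)) (F : 'M[K]_(M, N))
    (tau q : R) (W : 'M[K]_(M, N)) : 'M[K]_(M, N) :=
  sv_calculus (s_fun tau q)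
    (of_real k q *: F + orth_proj (orth_compl H) W).

End MatrixSpace.

Definition argmin (R : realType) (T : Type) (E : set T) (J : T -> R) : set T :=
  [set A | E A /\ forall B, E B -> J A <= J B].

(* Main.v *)
From HB Require Import structures.
From mathcomp Require Import fingroup perm.
Require Import Defs.
From mathcomp Require Import ring lra.

Set Implicit Arguments.
Unset Strict Implicit.
Unset Printing Implicit Defensive.

(** The operator [B] is a composition of two firmly nonexpansive maps: the
    projection [Q] onto the orthogonal complement of [H], followed (after a
    translation by [q F]) by the singular value shrinkage [S]. The shrinkage is
    firmly nonexpansive because [s] and [x - s x] are both nondecreasing; for
    functions of the singular values this is a consequence of the trace inequality
    of von Neumann ([von_neumann_trace], [sv_calculus_firm]). Hence [B] is averaged
    ([B_op_averaged]), and its orbits are bounded because [s] grows like [x / q]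
    with [q > 1] ([B_op_orbit_bounded]). In finite dimension the orbits of an
    averaged map with bounded orbits converge to fixed points
    ([averaged_picard]).

    For the optimality, the shrinkage is related to the objective by duality: if
    [Y = q F + Q W] and [W = S Y] is a fixed point, put [A = (Y - W) / (q - 1)].
    On the level of singular values, [s y] is a subgradient of the convex function
    [(tau^2 - max (tau - b, 0)^2 + b^2) / 2] at [(y - s y) / (q - 1)]
    ([s_fun_subgradient]), and the trace inequality lifts this to matrices. Since
    [Q W] is orthogonal to [H], the objective at any [B] in [H] exceeds the one at
    [A] by at least [(q - 1) |B - A|^2] ([fixed_point_growth]). So [A] is the only
    minimiser; and as [Y - W = q F - P W], where [P] is the projection onto [H],
    [P W] is determined by [A], hence is the same for all fixed points.

    The singular value decomposition itself is obtained variationally, for real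
    and complex matrices at once: among all unitary pairs, one that maximises the
    inner product of [A] with [U C V^H], for a diagonal matrix [C] of distinct
    weights, diagonalises [A] ([ex_unitary_max], [extremal_rect_diag], [ex_svd]).
    The singular values are unique by the trace inequality again
    ([svd_unique]). *)

(** * Real and complex scalars *)

Section Scalars.
Variables (R : realType) (k : scalar_kind).
Local Notation K := (scalars R k).
Implicit Types (x y : K) (a b : R).

Fact conj_scalar_zmod : GRing.zmod_morphism (@conj_scalar R k).
Proof. by case: k => x y //; apply: rmorphB. Qed.
Fact conj_scalar_monoid : GRing.monoid_morphism (@conj_scalar R k).
Proof.
case: k; split=> [|x y] //=; first by rewrite oppr0.
exact: (rmorphM conjc).
Qed.
HB.instance Definition _ :=
  GRing.isZmodMorphism.Build K K (conj_scalar k) conj_scalar_zmod.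
HB.instance Definition _ :=
  GRing.isMonoidMorphism.Build K K (conj_scalar k) conj_scalar_monoid.

Fact of_real_zmod : GRing.zmod_morphism (@of_real R k).
Proof. by case: k => x y //; apply: (rmorphB (real_complex R)). Qed.
Fact of_real_monoid : GRing.monoid_morphism (@of_real R k).
Proof. by case: k; split=> //= x y; exact: (rmorphM (real_complex R)). Qed.
HB.instance Definition _ :=
  GRing.isZmodMorphism.Build R K (of_real k) of_real_zmod.
HB.instance Definition _ :=
  GRing.isMonoidMorphism.Build R K (of_real k) of_real_monoid.

Fact re_part_zmod : GRing.zmod_morphism (@re_part R k).
Proof. by case: k => // -[a b] [c d]. Qed.
HB.instance Definition _ :=
  GRing.isZmodMorphism.Build K R (re_part k) re_part_zmod.

Lemma conj_scalarK : involutive (@conj_scalar R k).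
Proof. by case: k => // x; apply: conjcK. Qed.

Lemma conj_of_real a : conj_scalar k (of_real k a) = of_real k a.
Proof. by case: k => //=; apply: conjc_real. Qed.

Lemma re_of_real a : re_part k (of_real k a) = a.
Proof. by case: k. Qed.

Lemma re_conj x : re_part k (conj_scalar k x) = re_part k x.
Proof. by move: x; case: k => // -[]. Qed.

Lemma re_of_realM a x : re_part k (of_real k a * x) = a * re_part k x.
Proof. by move: x; case: k => //= -[c d] /=; rewrite mul0r subr0. Qed.

(** The squared modulus, with values in [R] whatever the scalars are, so that
    it can be compared with the other real quantities. *)
Definition sqmod x : R := re_part k (x * conj_scalar k x).

Lemma mul_conj_scalar x : x * conj_scalar k x = of_real k (sqmod x).
Proof.
rewrite /sqmod; move: x; case: k => //= -[a b] /=; apply/eqP.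
by rewrite eq_complex /= eqxx mulrN mulrC addrC subrr eqxx.
Qed.

Lemma re_sqr_le_sqmod x : re_part k x ^+ 2 <= sqmod x.
Proof.
rewrite /sqmod; move: x; case: k => //= -[a b] /=.
by rewrite mulrN opprK expr2 lerDl -expr2 sqr_ge0.
Qed.

Lemma sqmod_ge0 x : 0 <= sqmod x.
Proof. exact: le_trans (sqr_ge0 _) (re_sqr_le_sqmod x). Qed.

Lemma sqmod_eq0 x : (sqmod x == 0) = (x == 0).
Proof.
apply/eqP/eqP => [h|->]; last by rewrite /sqmod mul0r raddf0.
have := mul_conj_scalar x; rewrite h rmorph0 => /eqP.
by rewrite mulf_eq0 fmorph_eq0 orbb => /eqP.
Qed.

Lemma sqmodC x : sqmod (conj_scalar k x) = sqmod x.
Proof. by rewrite /sqmod conj_scalarK mulrC. Qed.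

Lemma sqmodD x y :
  sqmod (x + y) = sqmod x + sqmod y + 2 * re_part k (x * conj_scalar k y).
Proof.
rewrite /sqmod rmorphD mulrDl !mulrDr !raddfD /=.
rewrite -[re_part k (y * conj_scalar k x)]re_conj rmorphM /= conj_scalarK.
by rewrite [conj_scalar k y * x]mulrC mulr_natl mulr2n; ring.
Qed.

Lemma sqmod_of_real a : sqmod (of_real k a) = a ^+ 2.
Proof. by rewrite /sqmod conj_of_real -rmorphM re_of_real expr2. Qed.

Lemma sqmodM x y : sqmod (x * y) = sqmod x * sqmod y.
Proof.
rewrite {1}/sqmod rmorphM /= mulrACA !mul_conj_scalar -rmorphM.
by rewrite re_of_real.
Qed.

Lemma re_mul_le x y : 2 * re_part k (x * y) <= sqmod x + sqmod y.
Proof.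
have := sqmod_ge0 (x - conj_scalar k y).
rewrite sqmodD rmorphN /= conj_scalarK mulrN raddfN /= -(sqmodC y).
have -> : sqmod (- conj_scalar k y) = sqmod (conj_scalar k y).
  by rewrite /sqmod rmorphN /= mulrNN.
lra.
Qed.

Lemma normr_scalar x : `|x| = of_real k (Num.sqrt (sqmod x)).
Proof.
rewrite /sqmod; move: x; case: k => /= [x|[a b]].
  by rewrite -expr2 sqrtr_sqr.
by rewrite normc_def /= mulrN opprK -!expr2.
Qed.

Lemma of_real_lt a b : (of_real k a < of_real k b) = (a < b).
Proof. by case: k => //=; apply: ltcR. Qed.

Lemma gt0_of_real x : 0 < x -> exists2 e : R, 0 < e & x = of_real k e.
Proof.
move=> x0; exists (Num.sqrt (sqmod x)); last first.
  by rewrite -normr_scalar gtr0_norm.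
by rewrite sqrtr_gt0 lt_def sqmod_ge0 sqmod_eq0 gt_eqF.
Qed.

(** Real scalars get the imaginary unit [0]: in both cases every scalar is then
    [of_real a + iunit * of_real b], and compactness can be argued on real
    coordinates without a case distinction. *)
Definition iunit : K := match k with RealScalars => 0 | ComplexScalars => 'i%C
  end.

Lemma scalar_coords x : exists ab : R * R,
  [/\ x = of_real k ab.1 + iunit * of_real k ab.2,
   ab.1 ^+ 2 <= sqmod x & ab.2 ^+ 2 <= sqmod x].
Proof.
rewrite /sqmod /iunit; move: x; case: k => /= [x|[a b]].
  exists (x, 0); split=> /=; first by rewrite mulr0 addr0.
    by rewrite expr2.
  by rewrite expr0n -expr2 sqr_ge0.
exists (a, b); split=> //=; first by simpc.
  by rewrite mulrN opprK expr2 lerDl -expr2 sqr_ge0.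
by rewrite mulrN opprK expr2 lerDr -expr2 sqr_ge0.
Qed.

Lemma of_real_continuous : continuous (of_real k : R -> K).
Proof.
move=> a; apply/cvgrPdist_lt => e /gt0_of_real[e' e'0 ->].
near=> b; rewrite -rmorphB normr_scalar sqmod_of_real sqrtr_sqr of_real_lt.
by near: b; exact: (@cvgr_dist_lt _ _ _ (nbhs a) _ id).
Unshelve. all: by end_near. Qed.

Lemma re_part_continuous : continuous (re_part k : K -> R).
Proof.
move=> x; apply/(@cvgrPdist_lt _ _ _ (nbhs x)) => e e0.
have e0' : 0 < of_real k e by rewrite -(rmorph0 (of_real k)) of_real_lt.
near=> y; apply: (@le_lt_trans _ _ (Num.sqrt (sqmod (x - y)))).
  by rewrite -raddfB -sqrtr_sqr ler_wsqrtr ?re_sqr_le_sqmod.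
rewrite -of_real_lt -normr_scalar.
by near: y; exact: (@cvgr_dist_lt _ _ _ (nbhs x) _ id).
Unshelve. all: by end_near. Qed.

Lemma conj_scalar_continuous : continuous (conj_scalar k : K -> K).
Proof.
move=> x; apply/(@cvgrPdist_lt _ _ _ (nbhs x)) => e e0.
near=> y; rewrite -rmorphB normr_scalar sqmodC -normr_scalar.
by near: y; exact: (@cvgr_dist_lt _ _ _ (nbhs x) _ id).
Unshelve. all: by end_near. Qed.

End Scalars.

(** * Adjoints and the Frobenius inner product *)

Section InnerProduct.
Variables (R : realType) (k : scalar_kind).
Local Notation K := (scalars R k).
Local Notation "A ^H" := (adjoint A) (at level 8, format "A ^H").

Lemma adjointE M N (A : 'M[K]_(M, N)) i j : A^H i j = conj_scalar k (A j i).
Proof. by rewrite !mxE. Qed.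

Lemma adjointK M N (A : 'M[K]_(M, N)) : A^H^H = A.
Proof. by apply/matrixP => i j; rewrite !mxE conj_scalarK. Qed.

Lemma adjointM M N P (A : 'M[K]_(M, N)) (B : 'M[K]_(N, P)) :
  (A *m B)^H = B^H *m A^H.
Proof. by rewrite /adjoint map_mxM trmx_mul. Qed.

Lemma adjoint1 M : (1%:M : 'M[K]_M)^H = 1%:M.
Proof. by rewrite /adjoint map_mx1 trmx1. Qed.

Lemma adjointD M N (A B : 'M[K]_(M, N)) : (A + B)^H = A^H + B^H.
Proof. by rewrite /adjoint map_mxD linearD. Qed.

Lemma unitaryC M (U : 'M[K]_M) : unitary U -> U *m U^H = 1%:M.
Proof. exact: mulmx1C. Qed.

Lemma unitary1 M : unitary (1%:M : 'M[K]_M).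
Proof. by rewrite /unitary adjoint1 mulmx1. Qed.

Lemma unitaryM M (U V : 'M[K]_M) : unitary U -> unitary V -> unitary (U *m V).
Proof.
move=> uU uV; rewrite /unitary adjointM mulmxA -(mulmxA _ _ U) uU mulmx1.
exact: uV.
Qed.

Lemma unitary_adjoint M (U : 'M[K]_M) : unitary U -> unitary U^H.
Proof. by move=> uU; rewrite /unitary adjointK unitaryC. Qed.

Lemma unitary_row M (U : 'M[K]_M) i : unitary U -> \sum_j sqmod (U i j) = 1.
Proof.
move=> /unitaryC /matrixP /(_ i i); rewrite !mxE eqxx => h.
have := congr1 (re_part k) h; rewrite raddf_sum /=.
under eq_bigr do rewrite adjointE.
by move->; rewrite -(rmorph1 (of_real k)) re_of_real.
Qed.

Lemma unitary_col M (U : 'M[K]_M) j : unitary U -> \sum_i sqmod (U i j) = 1.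
Proof.
move=> /unitary_adjoint/unitary_row => /(_ j) <-.
by apply: eq_bigr => i _; rewrite adjointE sqmodC.
Qed.

Lemma frob_innerE M N (A B : 'M[K]_(M, N)) : frob_inner A B = \tr (A *m B^H).
Proof.
apply: eq_bigr => i _; rewrite mxE; apply: eq_bigr => j _.
by rewrite adjointE.
Qed.

Lemma frob_inner_conj M N (A B : 'M[K]_(M, N)) :
  frob_inner B A = conj_scalar k (frob_inner A B).
Proof.
rewrite /frob_inner rmorph_sum; apply: eq_bigr => i _.
rewrite rmorph_sum; apply: eq_bigr => j _.
by rewrite rmorphM /= conj_scalarK mulrC.
Qed.

Lemma frob_inner_mull M N P (U : 'M[K]_(M, P)) X (Y : 'M[K]_(M, N)) :
  frob_inner (U *m X) Y = frob_inner X (U^H *m Y).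
Proof.
by rewrite !frob_innerE adjointM adjointK mxtrace_mulC !mulmxA mxtrace_mulC
  mulmxA.
Qed.

Lemma frob_inner_mulr M N P (V : 'M[K]_(P, N)) X (Y : 'M[K]_(M, N)) :
  frob_inner (X *m V) Y = frob_inner X (Y *m V^H).
Proof. by rewrite !frob_innerE adjointM adjointK mulmxA. Qed.

Lemma frob_innerDl M N (A B C : 'M[K]_(M, N)) :
  frob_inner (A + B) C = frob_inner A C + frob_inner B C.
Proof. by rewrite !frob_innerE mulmxDl mxtraceD. Qed.

Lemma frob_innerZl M N a (A B : 'M[K]_(M, N)) :
  frob_inner (a *: A) B = a * frob_inner A B.
Proof. by rewrite !frob_innerE -scalemxAl mxtraceZ. Qed.

Lemma frob_innerNl M N (A B : 'M[K]_(M, N)) :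
  frob_inner (- A) B = - frob_inner A B.
Proof. by rewrite -scaleN1r frob_innerZl mulN1r. Qed.

Lemma frob_innerBl M N (A B C : 'M[K]_(M, N)) :
  frob_inner (A - B) C = frob_inner A C - frob_inner B C.
Proof. by rewrite frob_innerDl frob_innerNl. Qed.

(** The space of matrices is used as a real Euclidean space, also over the
    complex scalars: all estimates below are about this inner product. *)
Definition re_inner M N (A B : 'M[K]_(M, N)) : R := re_part k (frob_inner A B).

Lemma re_innerC M N (A B : 'M[K]_(M, N)) : re_inner A B = re_inner B A.
Proof. by rewrite /re_inner frob_inner_conj re_conj. Qed.

Lemma re_innerDl M N (A B C : 'M[K]_(M, N)) :
  re_inner (A + B) C = re_inner A C + re_inner B C.
Proof. by rewrite /re_inner frob_innerDl raddfD. Qed.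

Lemma re_inner0l M N (A : 'M[K]_(M, N)) : re_inner 0 A = 0.
Proof. by rewrite -(scale0r 0) /re_inner frob_innerZl mul0r raddf0. Qed.

Lemma re_innerNl M N (A B : 'M[K]_(M, N)) : re_inner (- A) B = - re_inner A B.
Proof. by rewrite /re_inner frob_innerNl raddfN. Qed.

Lemma re_innerZl M N a (A B : 'M[K]_(M, N)) :
  re_inner (of_real k a *: A) B = a * re_inner A B.
Proof. by rewrite /re_inner frob_innerZl re_of_realM. Qed.

Lemma re_innerDr M N (A B C : 'M[K]_(M, N)) :
  re_inner A (B + C) = re_inner A B + re_inner A C.
Proof. by rewrite ![re_inner A _]re_innerC re_innerDl. Qed.

Lemma re_innerNr M N (A B : 'M[K]_(M, N)) : re_inner A (- B) = - re_inner A B.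
Proof. by rewrite ![re_inner A _]re_innerC re_innerNl. Qed.

Lemma re_innerZr M N a (A B : 'M[K]_(M, N)) :
  re_inner A (of_real k a *: B) = a * re_inner A B.
Proof. by rewrite ![re_inner A _]re_innerC re_innerZl. Qed.

Definition re_innerE := (re_innerDl, re_innerDr, re_innerNl, re_innerNr,
  re_innerZl, re_innerZr).

Lemma re_inner_sqmod M N (A : 'M[K]_(M, N)) :
  re_inner A A = \sum_i \sum_j sqmod (A i j).
Proof.
by rewrite /re_inner raddf_sum; apply: eq_bigr => i _; rewrite raddf_sum.
Qed.

Lemma re_inner_ge0 M N (A : 'M[K]_(M, N)) : 0 <= re_inner A A.
Proof. by rewrite re_inner_sqmod !sumr_ge0 // => i _;
  rewrite sumr_ge0 // => j _; exact: sqmod_ge0. Qed.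

Lemma sqmod_le_re_inner M N (A : 'M[K]_(M, N)) i j :
  sqmod (A i j) <= re_inner A A.
Proof.
rewrite re_inner_sqmod (bigD1 i) //= (bigD1 j) //= -addrA lerDl addr_ge0 //.
  by rewrite sumr_ge0 // => l _; exact: sqmod_ge0.
by rewrite sumr_ge0 // => m _; rewrite sumr_ge0 // => l _; exact: sqmod_ge0.
Qed.

Lemma re_inner_eq0 M N (A : 'M[K]_(M, N)) : re_inner A A <= 0 -> A = 0.
Proof.
move=> h; apply/matrixP => i j; rewrite mxE; apply/eqP.
by rewrite -sqmod_eq0 eq_le sqmod_ge0 (le_trans (sqmod_le_re_inner A i j)).
Qed.

Lemma frob_norm_ge0 M N (A : 'M[K]_(M, N)) : 0 <= frob_norm A.
Proof. exact: sqrtr_ge0. Qed.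

Lemma frob_norm_sqr M N (A : 'M[K]_(M, N)) : frob_norm A ^+ 2 = re_inner A A.
Proof. by rewrite sqr_sqrtr ?re_inner_ge0. Qed.

Lemma frob_norm_le M N M' N' (A : 'M[K]_(M, N)) (B : 'M[K]_(M', N')) :
  re_inner A A <= re_inner B B -> frob_norm A <= frob_norm B.
Proof. by move=> h; rewrite ler_wsqrtr. Qed.

Lemma frob_normN M N (A : 'M[K]_(M, N)) : frob_norm (- A) = frob_norm A.
Proof.
by apply/eqP; rewrite eq_le !frob_norm_le // !re_innerE opprK.
Qed.

(** Cauchy-Schwarz: expand the square norm of [|B| A - |A| B]. *)
Lemma re_inner_le_frob_norm M N (A B : 'M[K]_(M, N)) :
  re_inner A B <= frob_norm A * frob_norm B.
Proof.
have [a0 b0] := (frob_norm_ge0 A, frob_norm_ge0 B).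
have h := re_inner_ge0 (of_real k (frob_norm B) *: A - of_real k (frob_norm A)
  *: B).
move: h; rewrite !re_innerE -!frob_norm_sqr (re_innerC B).
set a := frob_norm A in a0 *; set b := frob_norm B in b0 *.
move=> h; have {h} h : 0 <= a * b * (a * b - re_inner A B) by nra.
have [/eqP|ab0] := eqVneq (a * b) 0.
  rewrite mulf_eq0 => /orP[] /eqP z.
    have /re_inner_eq0 -> : re_inner A A <= 0
      by rewrite -frob_norm_sqr -/a z expr0n.
    by rewrite re_inner0l mulr_ge0.
  have /re_inner_eq0 -> : re_inner B B <= 0
    by rewrite -frob_norm_sqr -/b z expr0n.
  by rewrite re_innerC re_inner0l mulr_ge0.
by rewrite -subr_ge0 -(pmulr_rge0 _ (_ : 0 < a * b)) // lt_def ab0 mulr_ge0.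
Qed.

Lemma frob_norm_triangle M N (A B : 'M[K]_(M, N)) :
  frob_norm (A + B) <= frob_norm A + frob_norm B.
Proof.
rewrite -(@ler_pXn2r _ 2) ?nnegrE ?addr_ge0 ?frob_norm_ge0 //.
rewrite frob_norm_sqr !re_innerE (re_innerC B) -!frob_norm_sqr.
have := re_inner_le_frob_norm A B; nra.
Qed.

Lemma frob_norm_dist M N (A B : 'M[K]_(M, N)) :
  `|frob_norm A - frob_norm B| <= frob_norm (A - B).
Proof.
have h1 := frob_norm_triangle (A - B) B.
have h2 := frob_norm_triangle (- (A - B)) A.
rewrite subrK in h1; rewrite frob_normN opprB subrK in h2.
rewrite ler_norml; apply/andP; split; lra.
Qed.

End InnerProduct.

(** * The trace inequality *)

Section Rearrangement.
Variable R : realType.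

(** Dual certificate for the rearrangement inequality. Since [S] and [T] are
    antitone, [S i * T j] is a Monge array, so the assignment problem of
    maximising the sum of [S i * T (p i)] is solved by the identity. The
    potentials come from splitting each increment of the diagonal product into
    [(S l - S l.+1) * T l + S l.+1 * (T l - T l.+1)], the first half going to [u]
    and the second one to [v]; the boundary term at [n] is cancelled by
    [S n = 0]. *)
Lemma monge_potentials n (S T : nat -> R) :
    (forall i j, (i <= j)%N -> S j <= S i) ->
    (forall i j, (i <= j)%N -> T j <= T i) ->
    (forall i, 0 <= S i) -> (forall i, 0 <= T i) -> S n = 0 ->
  exists u v : nat -> R,
    [/\ forall i, (i <= n)%N -> 0 <= u i, forall i, (i <= n)%N -> 0 <= v i,
        forall i, (i <= n)%N -> u i + v i = S i * T i
      & forall i j, (i <= n)%N -> (j <= n)%N -> S i * T j <= u i + v j].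
Proof.
move=> aS aT S0 T0 Sn.
pose u i := \sum_(i <= l < n) (S l - S l.+1) * T l.
pose v i := \sum_(i <= l < n) S l.+1 * (T l - T l.+1).
have uv i : (i <= n)%N -> u i + v i = S i * T i.
  move=> le_in; rewrite -big_split /=.
  rewrite (eq_bigr (fun l => - (S l.+1 * T l.+1 - S l * T l))); last first.
    by move=> l _; ring.
  by rewrite sumrN telescope_sumr // Sn mul0r sub0r opprK.
exists u, v; split=> //.
- by move=> i _; apply: sumr_ge0 => l _; rewrite mulr_ge0 // subr_ge0 aS.
- by move=> i _; apply: sumr_ge0 => l _; rewrite mulr_ge0 // subr_ge0 aT.
move=> i j le_in le_jn; case: (leqP i j) => [le_ij|/ltnW le_ji].
  have -> : u i = \sum_(i <= l < j) (S l - S l.+1) * T l + u j.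
    by rewrite /u (big_cat_nat le_ij le_jn).
  suff: (S i - S j) * T j <= \sum_(i <= l < j) (S l - S l.+1) * T l.
    have := uv j le_jn; lra.
  rewrite -opprB -(telescope_sumr S le_ij) -sumrN mulr_suml !big_nat.
  apply: ler_sum => l /andP[_ /ltnW le_lj].
  by rewrite opprB ler_wpM2l ?aT // subr_ge0 aS.
have -> : v j = \sum_(j <= l < i) S l.+1 * (T l - T l.+1) + v i.
  by rewrite /v (big_cat_nat le_ji le_in).
suff: S i * (T j - T i) <= \sum_(j <= l < i) S l.+1 * (T l - T l.+1).
  have := uv i le_in; lra.
rewrite -opprB -(telescope_sumr T le_ji) -sumrN mulr_sumr !big_nat.
apply: ler_sum => l /andP[_ lt_li].
by rewrite opprB ler_wpM2r ?aS // subr_ge0 aT.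
Qed.

(** Weighting [s i * t j <= u i + v j] by [w] leaves only row and column sums,
    which are at most [1], so the total is at most that of the diagonal. *)
Lemma substochastic_rearrangement n (s t : 'I_n -> R) (w : 'I_n -> 'I_n -> R) :
    (forall i j : 'I_n, (i <= j)%N -> s j <= s i) ->
    (forall i j : 'I_n, (i <= j)%N -> t j <= t i) ->
    (forall i, 0 <= s i) -> (forall i, 0 <= t i) ->
    (forall i j, 0 <= w i j) ->
    (forall i, \sum_j w i j <= 1) -> (forall j, \sum_i w i j <= 1) ->
  \sum_i \sum_j w i j * (s i * t j) <= \sum_i s i * t i.
Proof.
move=> as_ at_ s0 t0 w0 wr wc.
(* Extension by zero provides the value [0] at [n] that the potentials need. *)
pose ext (f : 'I_n -> R) l := oapp f 0 (insub l).
have extE f i : ext f (val i) = f i by rewrite /ext valK.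
have ext0 f l : (forall i, 0 <= f i) -> 0 <= ext f l.
  by move=> f0; rewrite /ext; case: insub => /=.
have ext_anti f : (forall i, 0 <= f i) ->
    (forall i j : 'I_n, (i <= j)%N -> f j <= f i) ->
    forall i j, (i <= j)%N -> ext f j <= ext f i.
  move=> f0 af i j le_ij; case: (ltnP j n) => lt_jn; last first.
    by rewrite {1}/ext insubN ?ext0 // -leqNgt.
  have lt_in := leq_ltn_trans le_ij lt_jn.
  by rewrite (extE f (Ordinal lt_jn)) (extE f (Ordinal lt_in)) af.
have extn : ext s n = 0 by rewrite /ext insubN // ltnn.
have [u [v [u0 v0 uv le_uv]]] := monge_potentials (ext_anti s s0 as_)
  (ext_anti t t0 at_) (fun l => ext0 s l s0) (fun l => ext0 t l t0) extn.
have le_n (i : 'I_n) : (i <= n)%N := ltnW (ltn_ord i).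
apply: (@le_trans _ _ (\sum_(i < n) \sum_(j < n) (w i j * u i + w i j * v j))).
  apply: ler_sum => i _; apply: ler_sum => j _.
  by rewrite -mulrDr ler_wpM2l ?w0 // -[s i]extE -[t j]extE le_uv ?le_n.
under eq_bigr do rewrite big_split -mulr_suml /=.
rewrite big_split /= [X in _ + X]exchange_big /=.
under [X in _ + X]eq_bigr do rewrite -mulr_suml.
rewrite -big_split /=; apply: ler_sum => i _.
rewrite -[s i]extE -[t i]extE -uv ?le_n //.
by rewrite lerD // ler_piMl ?u0 ?v0 ?le_n.
Qed.

End Rearrangement.

Section RectDiag.
Variables (R : realType) (k : scalar_kind) (M N : nat).
Local Notation K := (scalars R k).
Local Notation n := (minn M N).
Local Notation "A ^H" := (adjoint A) (at level 8, format "A ^H").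
Local Notation drow := (widen_ord (geq_minl M N)).
Local Notation dcol := (widen_ord (geq_minr M N)).
Implicit Types s t : 'rV[R]_n.

Lemma rect_diag_delta s :
  rect_diag k s = \sum_l of_real k (s 0 l) *: delta_mx (drow l) (dcol l) :>
    'M[K]_(M, N).
Proof.
apply/matrixP => i j; rewrite mxE summxE big_mkcond; apply: eq_bigr => l _.
rewrite !mxE ![_ == drow l]eq_sym ![_ == dcol l]eq_sym -!val_eqE /=.
by case: ifP; rewrite ?mulr1 ?mulr0.
Qed.

Lemma mul_rect_diag P Q (X : 'M[K]_(P, M)) s (Y : 'M[K]_(N, Q)) a b :
  (X *m rect_diag k s *m Y) a b =
  \sum_l of_real k (s 0 l) * (X a (drow l) * Y (dcol l) b).
Proof.
rewrite rect_diag_delta mulmx_sumr mulmx_suml summxE; apply: eq_bigr => l _.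
rewrite -scalemxAr -scalemxAl mxE; congr (_ * _).
rewrite -(mul_delta_mx (0 : 'I_1)) mulmxA -[_ *m Y]mulmxA -colE -rowE mxE
  big_ord1.
by rewrite !mxE.
Qed.

Lemma frob_inner_delta (X : 'M[K]_(M, N)) i j :
  frob_inner X (delta_mx i j) = X i j.
Proof.
rewrite /frob_inner (bigD1 i) //= (bigD1 j) //= mxE !eqxx rmorph1 mulr1.
rewrite !big1 ?addr0 // => [i' ni|j' nj].
  by rewrite big1 // => j' _; rewrite mxE (negbTE ni) rmorph0 mulr0.
by rewrite mxE (negbTE nj) andbF rmorph0 mulr0.
Qed.

Lemma re_inner_rect_diag (X : 'M[K]_(M, N)) s :
  re_inner X (rect_diag k s) = \sum_l s 0 l * re_part k (X (drow l) (dcol l)).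
Proof.
rewrite rect_diag_delta re_innerC.
transitivity (\sum_l re_inner (of_real k (s 0 l) *: delta_mx (drow l) (dcol l))
  X).
  elim/big_ind2 : _ => [|x a y b <- <-|//]; first by rewrite re_inner0l.
  by rewrite re_innerDl.
by apply: eq_bigr => l _; rewrite re_innerZl re_innerC /re_inner frob_inner_delta.
Qed.

Lemma sum_drow_le (f : 'I_M -> R) :
  (forall i, 0 <= f i) -> \sum_l f (drow l) <= \sum_i f i.
Proof.
move=> f0; rewrite -(big_imset f) /=; last first.
  by move=> a b _ _ /(congr1 val) /= /val_inj.
by rewrite [leRHS](bigID (mem (drow @: 'I_n))) /= lerDl sumr_ge0.
Qed.

Lemma sum_dcol_le (f : 'I_N -> R) :
  (forall i, 0 <= f i) -> \sum_l f (dcol l) <= \sum_i f i.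
Proof.
move=> f0; rewrite -(big_imset f) /=; last first.
  by move=> a b _ _ /(congr1 val) /= /val_inj.
by rewrite [leRHS](bigID (mem (dcol @: 'I_n))) /= lerDl sumr_ge0.
Qed.

(** The left-hand side is bilinear in [s] and [t] with coefficients
    [P m l * Q l m]. By the inequality between geometric and arithmetic means
    these are dominated by the averages of the squared moduli, and the rows and
    columns of a unitary matrix are unit vectors: the averages form a doubly
    substochastic array. *)
Lemma re_inner_unitary_le (P : 'M[K]_M) (Q : 'M[K]_N) s t :
    unitary P -> unitary Q ->
    (forall l, 0 <= s 0 l) -> (forall l, 0 <= t 0 l) ->
    (forall l m : 'I_n, (l <= m)%N -> s 0 m <= s 0 l) ->
    (forall l m : 'I_n, (l <= m)%N -> t 0 m <= t 0 l) ->
  re_inner (P *m rect_diag k s *m Q) (rect_diag k t) <= \sum_l s 0 l * t 0 l.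
Proof.
move=> uP uQ s0 t0 as_ at_; rewrite re_inner_rect_diag.
pose w (l m : 'I_n) : R := (sqmod (P (drow m) (drow l)) + sqmod (Q (dcol l)
  (dcol m))) / 2.
apply: le_trans (substochastic_rearrangement (w := w) as_ at_ s0 t0 _ _ _).
- rewrite exchange_big /=; apply: ler_sum => m _.
  rewrite mul_rect_diag raddf_sum mulr_sumr; apply: ler_sum => l _.
  rewrite /= re_of_realM mulrCA mulrA [leLHS]mulrC ler_wpM2r ?mulr_ge0 //.
  rewrite /w ler_pdivlMr // mulrC; exact: re_mul_le.
- by move=> l m; rewrite divr_ge0 // addr_ge0 ?sqmod_ge0.
- move=> l; rewrite -mulr_suml big_split /= ler_pdivrMr // mul1r.
  rewrite -[X in _ <= X]/(1 + 1) -{1}(unitary_col (drow l) uP) -(unitary_row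
    (dcol l) uQ).
  apply: lerD.
    by apply: (sum_drow_le (f := fun a => sqmod (P a (drow l)))) => ?;
      exact: sqmod_ge0.
  by apply: (sum_dcol_le (f := fun a => sqmod (Q (dcol l) a))) => ?;
    exact: sqmod_ge0.
move=> m; rewrite -mulr_suml big_split /= ler_pdivrMr // mul1r.
rewrite -[X in _ <= X]/(1 + 1) -{1}(unitary_row (drow m) uP) -(unitary_col (dcol
  m) uQ).
apply: lerD.
  by apply: (sum_drow_le (f := fun a => sqmod (P (drow m) a))) => ?;
    exact: sqmod_ge0.
by apply: (sum_dcol_le (f := fun a => sqmod (Q a (dcol m)))) => ?;
  exact: sqmod_ge0.
Qed.

(** The trace inequality of von Neumann. All convexity arguments for functions of
    the singular values reduce to it, because it becomes an equality when the two
    matrices share their singular vectors ([re_inner_svd]). *)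
Lemma von_neumann_trace (A B : 'M[K]_(M, N)) U1 s V1 U2 t V2 :
  is_svd A U1 s V1 -> is_svd B U2 t V2 -> re_inner A B <= \sum_l s 0 l * t 0 l.
Proof.
move=> [uU1 uV1 s0 as_ ->] [uU2 uV2 t0 at_ ->].
rewrite /re_inner -frob_inner_mulr -[in X in frob_inner _ X](adjointK U2).
rewrite -frob_inner_mull -!mulmxA (mulmxA _ U1) mulmxA.
by apply: re_inner_unitary_le => //; apply: unitaryM => //;
  apply: unitary_adjoint.
Qed.

Lemma re_inner_svd (U : 'M[K]_M) (V : 'M[K]_N) s t : unitary U -> unitary V ->
  re_inner (U *m rect_diag k s *m V^H) (U *m rect_diag k t *m V^H) =
  \sum_l s 0 l * t 0 l.
Proof.
move=> uU uV; rewrite /re_inner -frob_inner_mulr -!mulmxA uV mulmx1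
  frob_inner_mull.
rewrite mulmxA uU mul1mx -/(re_inner _ _) re_inner_rect_diag;
  apply: eq_bigr => l _.
rewrite -[rect_diag k s]mul1mx -[_ *m rect_diag k s]mulmx1 mul_rect_diag.
rewrite (bigD1 l) //= !mxE !eqxx !mulr1 big1 ?addr0 => [|m nm].
  by rewrite re_of_real mulrC.
by rewrite !mxE -val_eqE /= eq_sym val_eqE (negbTE nm) mul0r mulr0.
Qed.

End RectDiag.

(** * Matrices whose trace is maximal over the unitary group *)

Section Extremal.
Variables (R : realType) (k : scalar_kind) (M : nat).
Local Notation K := (scalars R k).
Local Notation "A ^H" := (adjoint A) (at level 8, format "A ^H").
Implicit Types X G : 'M[K]_M.

Lemma adjointZ_delta M' N' (c : K) (i : 'I_M') (j : 'I_N') :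
  (c *: delta_mx i j)^H = conj_scalar k c *: delta_mx j i.
Proof.
apply/matrixP => a b; rewrite !mxE rmorphM /= rmorph_nat.
by rewrite andbC.
Qed.

Lemma unitary_phase (w : K) i : sqmod w = 1 ->
  unitary (1%:M + (w - 1) *: delta_mx i i : 'M[K]_M).
Proof.
move=> w1; rewrite /unitary adjointD adjoint1 adjointZ_delta.
rewrite mulmxDl !mulmxDr !mulmx1 mul1mx -scalemxAl -scalemxAr mul_delta_mx.
rewrite scalerA -addrA -!scalerDl rmorphB /=.
rewrite [X in X *: _](_ : _ = w * conj_scalar k w - 1); last by ring.
by rewrite mul_conj_scalar w1 (rmorph1 (of_real k)) subrr scale0r addr0.
Qed.

(** A Givens rotation: it is the identity plus [(a - 1) P + Z], where [P] is the
    projection onto two coordinates and [Z] is skew with [Z Z = - |b|^2 P], so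
    the unitarity relation collapses to [a^2 + |b|^2 = 1]. *)
Lemma unitary_rotation (a : R) (b : K) i j : i != j -> a ^+ 2 + sqmod b = 1 ->
  unitary (1%:M + (of_real k a - 1) *: (delta_mx i i + delta_mx j j) +
           (b *: delta_mx j i - conj_scalar k b *: delta_mx i j) : 'M[K]_M).
Proof.
move=> nij ab1; have nji : (j == i) = false by rewrite eq_sym (negbTE nij).
set P : 'M[K]_M := delta_mx i i + delta_mx j j.
set Z : 'M[K]_M := b *: delta_mx j i - conj_scalar k b *: delta_mx i j.
have PP : P *m P = P.
  rewrite mulmxDl !mulmxDr !mul_delta_mx_cond !eqxx (negbTE nij) nji.
  by rewrite !mulr0n !mulr1n addr0 add0r.
have PZ : P *m Z = Z.
  rewrite mulmxDl !mulmxBr -!scalemxAr !mul_delta_mx_cond !eqxx (negbTE nij) nji.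
  by rewrite !mulr0n !mulr1n !scaler0 subr0 sub0r addrC.
have ZP : Z *m P = Z.
  rewrite mulmxDr !mulmxBl -!scalemxAl !mul_delta_mx_cond !eqxx (negbTE nij) nji.
  by rewrite !mulr0n !mulr1n !scaler0 subr0 sub0r.
have ZZ : Z *m Z = - (of_real k (sqmod b) *: P).
  rewrite mulmxBl !mulmxBr -!scalemxAl -!scalemxAr !mul_delta_mx_cond !eqxx.
  rewrite (negbTE nij) nji !mulr0n !mulr1n !scaler0 sub0r subr0 !scalerA.
  by rewrite mul_conj_scalar [_ * b]mulrC mul_conj_scalar -opprD -scalerDr addrC.
have PH : P^H = P.
  by rewrite adjointD -[delta_mx i i]scale1r -[delta_mx j j]scale1r
    !adjointZ_delta (rmorph1 (conj_scalar k)) !scale1r.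
have ZH : Z^H = - Z.
  rewrite /Z adjointD -scaleNr !adjointZ_delta rmorphN /= conj_scalarK.
  by rewrite !scaleNr opprB.
have cPH : ((of_real k a - 1) *: P)^H = (of_real k a - 1) *: P.
  rewrite /P scalerDr adjointD !adjointZ_delta rmorphB /= rmorph1.
  by rewrite conj_of_real.
clearbody P Z.
rewrite /unitary (adjointD (_ + _)) adjointD adjoint1 cPH ZH.
rewrite !mulmxDl !mulmxDr !mulmx1 !mul1mx !mulNmx.
rewrite -!scalemxAl -!scalemxAr PP PZ ZP ZZ.
set c := of_real k a - 1; rewrite opprK.
have e : c + c + c * c + of_real k (sqmod b) = 0.
  have -> : sqmod b = 1 - a ^+ 2 by rewrite -ab1; ring.
  by rewrite rmorphB rmorphXn rmorph1 /c; ring.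
rewrite scalerA.
transitivity (1%:M + (c + c + c * c + of_real k (sqmod b)) *: P).
  rewrite !scalerDl; set A1 := c *: P; set A2 := (c * c) *: P.
  set A3 := c *: Z; set A4 := (_ *: P); move: (1%:M : 'M[K]_M) => I.
  apply/matrixP => x y; rewrite !mxE; ring.
by rewrite e scale0r addr0.
Qed.

Lemma re_inner_delta (X : 'M[K]_M) c i j :
  re_inner X (c *: delta_mx i j) = re_part k (conj_scalar k c * X i j).
Proof.
by rewrite re_innerC /re_inner frob_innerZl frob_inner_conj frob_inner_delta
  -re_conj
  rmorphM /= conj_scalarK.
Qed.

(** Turning the [i]-th coordinate by the phase of [X i i] replaces [re (X i i)]
    by the modulus of [X i i]; maximality makes the two equal. *)
Lemma extremal_diag X i : (forall G, unitary G ->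
  re_inner X G <= re_inner X 1%:M) ->
  0 <= re_part k (X i i) /\ X i i = of_real k (re_part k (X i i)).
Proof.
move=> extX; set x := X i i; have [->|x0] := eqVneq x 0.
  by rewrite raddf0 rmorph0.
set m := Num.sqrt (sqmod x).
have mm : m ^+ 2 = sqmod x by rewrite sqr_sqrtr // sqmod_ge0.
have m0 : 0 < m by rewrite sqrtr_gt0 lt_def sqmod_ge0 sqmod_eq0 x0.
have w1 : sqmod (x * of_real k m^-1) = 1.
  by rewrite sqmodM sqmod_of_real -mm exprVn divff // expf_neq0 ?gt_eqF.
have := extX _ (unitary_phase i w1); rewrite re_innerDr re_inner_delta -/x gerDl.
rewrite rmorphB /= rmorph1 mulrBl mul1r raddfB /= subr_le0.
rewrite rmorphM /= conj_of_real mulrAC [_ * x]mulrC mul_conj_scalar -rmorphM.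
rewrite re_of_real -mm expr2 mulfK ?gt_eqF // => mx.
split; first exact: le_trans (ltW m0) mx.
apply/eqP; rewrite -subr_eq0 -sqmod_eq0 eq_le sqmod_ge0 andbT.
rewrite -rmorphN sqmodD sqmod_of_real conj_of_real [x * _]mulrC re_of_realM -mm.
by move: (re_part k x) mx => r mr; nra.
Qed.

(** First-order condition along a rotation in the plane of [i] and [j]. If
    [z = conj (X j i) - X i j] were nonzero, the rotation of sine [e * conj z]
    would gain [e * |z|^2], while its cosine only loses an amount of order
    [e^2 * |z|^2]. *)
Lemma extremal_hermitian X i j : (forall G, unitary G ->
  re_inner X G <= re_inner X 1%:M) ->
  i != j -> X i j = conj_scalar k (X j i).
Proof.
move=> extX nij; set z := conj_scalar k (X j i) - X i j.
suff : z = 0 by move/eqP; rewrite subr_eq0 => /eqP.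
apply/eqP; rewrite -sqmod_eq0; apply/negPn/negP => z0.
set w := sqmod z; have w0 : 0 < w by rewrite lt_def z0 sqmod_ge0.
set T := re_part k (X i i) + re_part k (X j j).
(* Small enough for [e * |T| < 1] and for [1 - e^2 * w] to have a square root. *)
pose e := (1 + w + `|T|)^-1.
have d0 : 0 < 1 + w + `|T| by have := normr_ge0 T; lra.
have e0 : 0 < e by rewrite invr_gt0.
have ed : e * (1 + w + `|T|) = 1 by rewrite mulVf ?gt_eqF.
have eT : e * `|T| < 1.
  rewrite -ed ltr_pM2l //; lra.
have ew1 : e ^+ 2 * w <= 1.
  have ew : e * w <= 1 by rewrite -ed ler_pM2l //; have := normr_ge0 T; lra.
  have e1 : e <= 1 by rewrite -ed ler_peMr ?(ltW e0) //; have := normr_ge0 T; lra.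
  rewrite expr2 -mulrA; apply: le_trans ew.
  by rewrite ler_piMl // mulr_ge0 // ltW.
set b := of_real k e * conj_scalar k z.
have wb : sqmod b = e ^+ 2 * w by rewrite sqmodM sqmod_of_real sqmodC.
set a := Num.sqrt (1 - e ^+ 2 * w).
have aa : a ^+ 2 = 1 - e ^+ 2 * w by rewrite sqr_sqrtr ?subr_ge0.
have a0 : 0 <= a := sqrtr_ge0 _.
have := extX _ (unitary_rotation nij (_ : a ^+ 2 + sqmod b = 1)).
rewrite aa wb subrK => /(_ erefl).
rewrite !re_innerDr -addrA gerDl scalerDr re_innerDr !re_inner_delta re_innerNr
  re_inner_delta.
rewrite rmorphB /= rmorph1 conj_of_real conj_scalarK !mulrBl !mul1r !raddfB /=.
rewrite !re_of_realM -(re_conj (conj_scalar k b * _)) rmorphM /= conj_scalarK.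
have -> : re_part k (b * conj_scalar k (X j i)) - re_part k (b * X i j) = e * w.
  by rewrite -raddfB /= -mulrBr -/z /b -mulrA [conj_scalar k z * z]mulrC
    mul_conj_scalar re_of_realM re_of_real.
rewrite -/w => h.
have {}h : e * w <= (1 - a) * T by rewrite /T; lra.
have a1 : a <= 1.
  have := mulr_ge0 (ltW (mulr_gt0 e0 e0)) (ltW w0); nra.
have ha : 1 - a <= e ^+ 2 * w by nra.
have : (1 - a) * T <= e ^+ 2 * w * `|T|.
  apply: (@le_trans _ _ ((1 - a) * `|T|)).
    by rewrite ler_wpM2l ?subr_ge0 // ler_norm.
  by rewrite ler_wpM2r.
move=> /(le_trans h) h2; have eT' : 0 < 1 - e * `|T| by rewrite subr_gt0.
have := mulr_gt0 (mulr_gt0 e0 w0) eT'.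
have -> : e * w * (1 - e * `|T|) = e * w - e ^+ 2 * w * `|T| by ring.
by rewrite subr_gt0 ltNge h2.
Qed.

End Extremal.

(** * Compactness and maximisation over pairs of unitary matrices *)

Section EntrywiseContinuity.
Variables (R : realType) (k : scalar_kind) (T : topologicalType).
Local Notation K := (scalars R k).
Local Notation "A ^H" := (adjoint A) (at level 8, format "A ^H").

Definition mx_continuous M N (X : T -> 'M[K]_(M, N)) :=
  forall i j, continuous ((fun t => X t i j) : T -> K).

Lemma mx_continuous_cst M N (A : 'M[K]_(M, N)) : mx_continuous (fun=> A).
Proof. by move=> i j t; apply: cvg_cst. Qed.

Lemma mx_continuousM M N P (X : T -> 'M[K]_(M, N)) (Y : T -> 'M[K]_(N, P)) :
  mx_continuous X -> mx_continuous Y -> mx_continuous (fun t => X t *m Y t).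
Proof.
move=> cX cY i j.
rewrite (_ : (fun t => _) = fun t => \sum_l X t i l * Y t l j); last first.
  by apply/funext => t; rewrite mxE.
by apply: (continuous_big (@add_continuous K)) => l _ t; apply: cvgM;
  [apply: cX|apply: cY].
Qed.

Lemma mx_continuous_adjoint M N (X : T -> 'M[K]_(M, N)) :
  mx_continuous X -> mx_continuous (fun t => (X t)^H).
Proof.
move=> cX i j.
rewrite (_ : (fun t => _) = fun t => conj_scalar k (X t j i)); last first.
  by apply/funext => t; rewrite adjointE.
move=> t; apply: (@continuous_comp _ _ _ (fun t => X t j i) (conj_scalar k)).
  exact: cX.
exact: conj_scalar_continuous.
Qed.

Lemma re_inner_continuous M N (X Y : T -> 'M[K]_(M, N)) :
  mx_continuous X -> mx_continuous Y ->
  continuous ((fun t => re_inner (X t) (Y t)) : T -> R).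
Proof.
move=> cX cY t.
apply: (@continuous_comp _ _ _ (fun t => frob_inner (X t) (Y t)) (re_part k));
  last exact: re_part_continuous.
move: t; apply: (continuous_big (@add_continuous K)) => i _.
apply: (continuous_big (@add_continuous K)) => j _ t.
apply: cvgM; first exact: cX.
apply: (@continuous_comp _ _ _ (fun t => Y t i j) (conj_scalar k)).
  exact: cY.
exact: conj_scalar_continuous.
Qed.

Lemma closed_unitary M (X : T -> 'M[K]_M) :
  mx_continuous X -> closed [set t | unitary (X t)].
Proof.
move=> cX; have cG := mx_continuousM (mx_continuous_adjoint cX) cX.
pose G t := (X t)^H *m X t.
rewrite (_ : [set t | _] = \bigcap_ij
  ((fun t => G t ij.1 ij.2) @^-1` [set (1%:M : 'M[K]_M) ij.1 ij.2])); last first.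
  apply/seteqP; split=> [t /= ut ij _|t h]; first by rewrite /= /G ut.
  by apply/matrixP => i j; exact: (h (i, j)).
apply: closed_bigI => ij _; apply: preimage_closed.
  by move=> t _; apply: cG.
apply: accessible_closed_set1; apply: hausdorff_accessible.
exact: norm_hausdorff.
Qed.

End EntrywiseContinuity.

Section Coordinates.
Variables (R : realType) (k : scalar_kind).
Local Notation K := (scalars R k).
Local Notation "A ^H" := (adjoint A) (at level 8, format "A ^H").

Local Notation coords I := (prod_topology (fun _ : bool * I => R)).

(** A matrix from its real and imaginary coordinates, flagged by a boolean; [h]
    places the entries in a larger index set, so that one point of the coordinate
    space can hold several matrices. *)
Definition mx_of_coords M N (I : Type) (h : 'I_M * 'I_N -> I)
    (f : bool * I -> R) : 'M[K]_(M, N) :=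
  \matrix_(i, j) (of_real k (f (false, h (i, j))) +
                  iunit R k * of_real k (f (true, h (i, j)))).

Lemma mx_of_coords_continuous M N (I : eqType) (h : 'I_M * 'I_N -> I) :
  mx_continuous (mx_of_coords h : coords I -> _).
Proof.
move=> i j; pose c b : coords I -> K := fun f => of_real k (f (b, h (i, j))).
have cc b : continuous (c b).
  move=> t; apply: (@continuous_comp _ _ _ (fun f : coords I => f (b, h (i, j)))).
    exact: proj_continuous.
  exact: of_real_continuous.
rewrite (_ : (fun t => _) = c false \+ ( *%R (iunit R k) \o c true)); last first.
  by apply/funext => t; rewrite mxE.
move=> t; apply: (@continuousD _ _ _ (c false) ( *%R (iunit R k) \o c true)).
  exact: (cc false).
exact: (@continuous_comp _ _ _ (c true) ( *%R (iunit R k)) t (cc true t)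
  (@mulrl_continuous K _ _)).
Qed.

Lemma ex_coords (I : Type) (F : I -> K) : exists f : bool * I -> R,
  forall l, [/\ F l = of_real k (f (false, l)) + iunit R k * of_real k (f (true,
    l))
    & forall b, f (b, l) ^+ 2 <= sqmod (F l)].
Proof.
have /choice[g gP] : forall l, exists ab : R * R,
    [/\ F l = of_real k ab.1 + iunit R k * of_real k ab.2,
   ab.1 ^+ 2 <= sqmod (F l) & ab.2 ^+ 2 <= sqmod (F l)].
  by move=> l; exact: scalar_coords.
exists (fun bl => if bl.1 then (g bl.2).2 else (g bl.2).1) => l /=.
by have [e h1 h2] := gP l; split=> // -[].
Qed.

Lemma box_compact (I : eqType) (r : R) :
  compact [set f : coords I | forall l, `[- r, r]%classic (f l)].
Proof.
apply: (@tychonoff _ (fun=> R) (fun=> `[- r, r]%classic)) => l.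
exact: (@segment_compact R).
Qed.

Lemma sqr_le_box (r x : R) : 0 <= r -> x ^+ 2 <= r ^+ 2 -> `[- r, r]%classic x.
Proof.
move=> r0; rewrite -(real_normK (num_real x)) ler_sqr ?nnegrE // ler_norml.
by rewrite /= in_itv.
Qed.

(** Entries of unitary matrices have real coordinates in [[-1, 1]], so pairs of
    unitary matrices are the points of a closed subset of a compact box. *)
Lemma ex_unitary_max M N (A C : 'M[K]_(M, N)) : exists U V,
  [/\ unitary U, unitary V & forall U' V', unitary U' -> unitary V' ->
    re_inner A (U' *m C *m V'^H) <= re_inner A (U *m C *m V^H)].
Proof.
pose I : eqType := ('I_M * 'I_M + 'I_N * 'I_N)%type.
pose T : topologicalType := coords I.
pose U : T -> 'M[K]_M := mx_of_coords inl.
pose V : T -> 'M[K]_N := mx_of_coords inr.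
have cU : mx_continuous U by exact: mx_of_coords_continuous.
have cV : mx_continuous V by exact: mx_of_coords_continuous.
pose E : set T := [set f | forall l, `[- 1, 1]%classic (f l)] `&`
  ([set f | unitary (U f)] `&` [set f | unitary (V f)]).
have ex U' V' : unitary U' -> unitary V' -> exists2 f, E f & U f = U' /\ V f = V'.
  move=> uU uV.
  pose F (l : I) := match l with inl ij => U' ij.1 ij.2 | inr ij => V' ij.1 ij.2
    end.
  have [f fP] := ex_coords F.
  have eU : U f = U' by apply/matrixP => i j; rewrite mxE;
    have [<-] := fP (inl (i, j)).
  have eV : V f = V' by apply/matrixP => i j; rewrite mxE;
    have [<-] := fP (inr (i, j)).
  exists f => //; split; last by split=> /=; rewrite ?eU ?eV.
  move=> [b l]; apply: sqr_le_box => //; rewrite expr1n.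
  have [_ h] := fP l; apply: le_trans (h b) _; case: l {h} => -[i j] /=.
    rewrite -(unitary_row i uU) (bigD1 j) //= lerDl sumr_ge0 // => m _.
    exact: sqmod_ge0.
  rewrite -(unitary_row i uV) (bigD1 j) //= lerDl sumr_ge0 // => m _.
  exact: sqmod_ge0.
have cE : compact E.
  apply: compact_closedI; first exact: box_compact.
  by apply: closedI; apply: closed_unitary.
have E0 : E !=set0.
  by have [f Ef _] := ex _ _ (unitary1 R k M) (unitary1 R k N); exists f.
have cf : {within E, continuous (fun f => re_inner A (U f *m C *m (V f)^H) : R)}.
  apply: continuous_subspaceT; apply: re_inner_continuous;
    first exact: mx_continuous_cst.
  apply: mx_continuousM; last exact: mx_continuous_adjoint.
  by apply: mx_continuousM => //; exact: mx_continuous_cst.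
have [f] := compact_EVT_max E0 cE cf; rewrite inE => -[_ [uU uV]] fmax.
exists (U f), (V f); split=> // U' V' uU' uV'.
by have [g Eg [<- <-]] := ex U' V' uU' uV'; apply: fmax; rewrite inE.
Qed.

End Coordinates.

(** * Existence and uniqueness of singular values *)

Section SVD.
Variables (R : realType) (k : scalar_kind) (M N : nat).
Local Notation K := (scalars R k).
Local Notation n := (minn M N).
Local Notation "A ^H" := (adjoint A) (at level 8, format "A ^H").
Local Notation drow := (widen_ord (geq_minl M N)).
Local Notation dcol := (widen_ord (geq_minr M N)).
Implicit Types A B C : 'M[K]_(M, N).

Lemma unitary_perm p (s : 'S_p) : unitary (perm_mx s : 'M[K]_p).
Proof.
by rewrite /unitary /adjoint map_perm_mx tr_perm_mx -perm_mxM mulVg perm_mx1.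
Qed.

Lemma rect_diag_entry (s : 'rV[R]_n) l m :
  rect_diag k s (drow l) (dcol m) = if l == m then of_real k (s 0 l) else 0.
Proof.
rewrite mxE big_mkcond (bigD1 l) //= eqxx big1 ?addr0 // => a nal.
by rewrite val_eqE (negbTE nal).
Qed.

Lemma rect_diag_off (s : 'rV[R]_n) (i : 'I_M) (j : 'I_N) :
  i != j :> nat -> rect_diag k s i j = 0.
Proof.
move=> nij; rewrite mxE big1 // => l /andP[/eqP li /eqP lj].
by rewrite -li -lj eqxx in nij.
Qed.

Lemma mul_rect_diag_adjoint B (c : 'rV[R]_n) i l :
  (B *m (rect_diag k c)^H) i (drow l) = B i (dcol l) * of_real k (c 0 l).
Proof.
rewrite mxE (bigD1 (dcol l)) //= adjointE rect_diag_entry eqxx conj_of_real.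
rewrite big1 ?addr0 // => j nj; rewrite adjointE rect_diag_off ?rmorph0 ?mulr0 //.
by rewrite eq_sym.
Qed.

Lemma mul_rect_diag_adjoint0 B (c : 'rV[R]_n) i (j : 'I_M) : (N <= j)%N ->
  (B *m (rect_diag k c)^H) i j = 0.
Proof.
move=> le_Nj; rewrite mxE big1 // => a _; rewrite adjointE rect_diag_off.
  by rewrite rmorph0 mulr0.
by rewrite gtn_eqF // (leq_trans _ le_Nj).
Qed.

Lemma adjoint_rect_diag_mul B (c : 'rV[R]_n) l j :
  ((rect_diag k c)^H *m B) (dcol l) j = of_real k (c 0 l) * B (drow l) j.
Proof.
rewrite mxE (bigD1 (drow l)) //= adjointE rect_diag_entry eqxx conj_of_real.
rewrite big1 ?addr0 // => i ni; rewrite adjointE rect_diag_off ?rmorph0 ?mul0r //.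
Qed.

Lemma adjoint_rect_diag_mul0 B (c : 'rV[R]_n) (i : 'I_N) j : (M <= i)%N ->
  ((rect_diag k c)^H *m B) i j = 0.
Proof.
move=> le_Mi; rewrite mxE big1 // => a _; rewrite adjointE rect_diag_off.
  by rewrite rmorph0 mul0r.
by rewrite ltn_eqF // (leq_trans _ le_Mi).
Qed.

Lemma ord_drow (i : 'I_M) : (i < N)%N -> exists l, i = drow l.
Proof.
move=> lt_iN; have lt_in : (i < n)%N by rewrite leq_min ltn_ord.
by exists (Ordinal lt_in); exact: val_inj.
Qed.

Lemma ord_dcol (i : 'I_N) : (i < M)%N -> exists l, i = dcol l.
Proof.
move=> lt_iM; have lt_in : (i < n)%N by rewrite leq_min ltn_ord andbT.
by exists (Ordinal lt_in); exact: val_inj.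
Qed.

(** With [C] diagonal with distinct positive weights, extremality of [B] on the
    left makes [B C^H] hermitian with nonnegative diagonal, and extremality on
    the right makes [C^H B] hermitian. For [i != j] these give
    [c_i (c_i b_ij) = c_i c_j conj b_ji = c_j (c_j b_ij)], and [c_i^2 != c_j^2]
    forces [b_ij = 0]. Exchanging two diagonal entries of [C] by permutations
    shows that the diagonal of [B] is ordered like the weights. *)
Lemma extremal_rect_diag B (c : 'rV[R]_n) :
    (forall l, 0 < c 0 l) -> (forall l m : 'I_n, (l < m)%N -> c 0 m < c 0 l) ->
    (forall G H, unitary G -> unitary H ->
       re_inner B (G *m rect_diag k c *m H^H) <= re_inner B (rect_diag k c)) ->
  exists s : 'rV[R]_n, [/\ forall l, 0 <= s 0 l,
    forall l m : 'I_n, (l <= m)%N -> s 0 m <= s 0 l & B = rect_diag k s].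
Proof.
set C := rect_diag k c => c0 dc extB.
have extX G : unitary G -> re_inner (B *m C^H) G <= re_inner (B *m C^H) 1%:M.
  move=> uG; rewrite /re_inner !frob_inner_mulr adjointK mul1mx -!/(re_inner _ _).
  by have := extB _ _ uG (unitary1 R k N); rewrite adjoint1 mulmx1.
have extY G : unitary G -> re_inner (C^H *m B) G <= re_inner (C^H *m B) 1%:M.
  move=> uG; rewrite /re_inner !frob_inner_mull adjointK mulmx1 -!/(re_inner _ _).
  have := extB _ _ (unitary1 R k M) (unitary_adjoint uG).
  by rewrite adjointK mul1mx.
have offB (i : 'I_M) (j : 'I_N) : i != j :> nat -> B i j = 0.
  (* Outside the square part of a rectangular matrix one of the two products
     vanishes, and a single hermitian relation suffices. *)
  move=> nij; case: (ltnP j M) => [/ord_dcol[m jm]|le_Mj].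
    case: (ltnP i N) => [/ord_drow[l il]|le_Ni].
      have nlm : l != m by apply: contraNN nij => /eqP lm; rewrite il jm lm.
      have nlm1 : drow l != drow m by rewrite -val_eqE.
      have nlm2 : dcol l != dcol m by rewrite -val_eqE.
      have := extremal_hermitian extX nlm1; have := extremal_hermitian extY nlm2.
      rewrite !mul_rect_diag_adjoint !adjoint_rect_diag_mul !rmorphM /=.
      rewrite !conj_of_real il jm => e1 e2.
      (* The two hermitian relations combine to [(c_l^2 - c_m^2) b_lm = 0]. *)
      have e3 : (of_real k (c 0 l ^+ 2 - c 0 m ^+ 2)) * B (drow l) (dcol m) = 0.
        rewrite rmorphB !rmorphXn mulrBl !expr2 -!mulrA e1.
        by rewrite [_ * B (drow l) _]mulrC e2; ring.
      move/eqP: e3; rewrite mulf_eq0 fmorph_eq0 subr_sqr mulf_eq0 subr_eq0.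
      rewrite [c 0 l + _ == 0]gt_eqF ?addr_gt0 // orbF.
      have -> : (c 0 l == c 0 m) = false; last by move/eqP.
      by case: (ltngtP l m) nlm => [/dc h|/dc h|/val_inj ->];
        rewrite ?eqxx // => _; [rewrite gt_eqF|rewrite lt_eqF].
    have nim : i != drow m by rewrite -val_eqE /= neq_ltn (leq_trans _ le_Ni)
      ?orbT // (leq_trans (ltn_ord m)) ?geq_minr.
    have := extremal_hermitian extX nim; rewrite mul_rect_diag_adjoint.
    rewrite mul_rect_diag_adjoint0 // rmorph0 -jm => /eqP.
    by rewrite mulf_eq0 fmorph_eq0 [c 0 m == 0]gt_eqF // orbF => /eqP.
  have lt_iN : (i < N)%N.
    by apply: leq_trans (ltn_ord j); rewrite ltnS (leq_trans _ le_Mj) // ltnW.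
  have [l il] := ord_drow lt_iN.
  have nlj : dcol l != j by rewrite -val_eqE /= neq_ltn (leq_trans _ le_Mj) //
    (leq_trans (ltn_ord l)) ?geq_minl.
  have := extremal_hermitian extY nlj; rewrite adjoint_rect_diag_mul.
  rewrite adjoint_rect_diag_mul0 // rmorph0 -il => /eqP.
  by rewrite mulf_eq0 fmorph_eq0 [c 0 l == 0]gt_eqF // => /eqP.
have diagB l : 0 <= re_part k (B (drow l) (dcol l)) /\
    B (drow l) (dcol l) = of_real k (re_part k (B (drow l) (dcol l))).
  have [] := extremal_diag (drow l) extX; rewrite mul_rect_diag_adjoint mulrC.
  rewrite re_of_realM pmulr_rge0 // => h1 h2; split=> //.
  rewrite rmorphM in h2; apply: mulfI h2.
  by rewrite fmorph_eq0 gt_eqF.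
pose s : 'rV[R]_n := \row_l re_part k (B (drow l) (dcol l)).
have Bs : B = rect_diag k s.
  apply/matrixP => i j; case: (eqVneq (i : nat) j) => [ij|nij]; last first.
    by rewrite offB // rect_diag_off.
  have lt_iN : (i < N)%N by rewrite ij.
  have [l il] := ord_drow lt_iN.
  have jl : j = dcol l by apply: val_inj; rewrite /= -ij il.
  by rewrite il jl rect_diag_entry eqxx mxE; have [_ {1}->] := diagB l.
exists s; split=> // [l|l m]; first by rewrite mxE; have [] := diagB l.
rewrite leq_eqVlt => /orP[/eqP/val_inj -> //|lt_lm].
have nml : m != l by rewrite -val_eqE gtn_eqF.
have := extB _ _ (unitary_perm (tperm (drow l) (drow m))) (unitary_perm (tperm
  (dcol l) (dcol m))).
rewrite {1}/adjoint map_perm_mx tr_perm_mx -row_permE -col_permE.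
rewrite Bs ![re_inner (rect_diag k s) _]re_innerC !re_inner_rect_diag.
have ent a : (col_perm (tperm (dcol l) (dcol m)) (row_perm (tperm (drow l) (drow
  m)) C)) (drow a) (dcol a)
    = of_real k (c 0 (tperm l m a)).
  rewrite !mxE -[X in _ = X]/(of_real k (c 0 (tperm l m a))).
  have -> : tperm (drow l) (drow m) (drow a) = drow (tperm l m a).
    by rewrite -(@inj_tperm _ _ drow) // => x y /(congr1 val) /= /val_inj.
  have -> : tperm (dcol l) (dcol m) (dcol a) = dcol (tperm l m a).
    by rewrite -(@inj_tperm _ _ dcol) // => x y /(congr1 val) /= /val_inj.
  have := rect_diag_entry c (tperm l m a) (tperm l m a).
  by rewrite eqxx mxE.
under eq_bigr do rewrite ent re_of_real.
under [X in _ <= X]eq_bigr do rewrite rect_diag_entry eqxx re_of_real.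
rewrite (bigD1 l) //= (bigD1 m) //= [X in _ <= X](bigD1 l) //=.
rewrite [X in _ <= _ + X](bigD1 m) //= tpermL tpermR.
rewrite (eq_bigr (fun a => s 0 a * c 0 a)); last first.
  by move=> a /andP[al am]; rewrite tpermD // eq_sym.
rewrite !addrA lerD2r => h; have := dc _ _ lt_lm.
move: (s 0 l) (s 0 m) (c 0 l) (c 0 m) h => x y a b h lt_ba.
rewrite -subr_ge0 -(pmulr_lge0 _ (_ : 0 < a - b)) ?subr_gt0 //; lra.
Qed.

(** Pick unitary [U] and [V] that maximise the inner product of [A] with
    [U C V^H], [C] being diagonal with decreasing weights: then [U^H A V] is
    extremal for [C]. *)
Lemma ex_svd A : exists U s V, is_svd A U s V.
Proof.
(* The weights [n, n - 1, ..., 1]. *)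
pose c : 'rV[R]_n := \row_l (n - l)%:R.
have [U [V [uU uV maxUV]]] := ex_unitary_max A (rect_diag k c).
have key G H : re_inner (U^H *m A *m V) (G *m rect_diag k c *m H^H) =
    re_inner A ((U *m G) *m rect_diag k c *m (V *m H)^H).
  rewrite /re_inner frob_inner_mulr frob_inner_mull adjointK adjointM.
  by rewrite !mulmxA.
have [|l m lt_lm|G H uG uH|s [s0 as_ e]] := @extremal_rect_diag (U^H *m A *m V) c.
- by move=> l; rewrite mxE ltr0n subn_gt0.
- by rewrite !mxE ltr_nat ltn_sub2l.
- have := key 1%:M 1%:M; rewrite adjoint1 mul1mx !mulmx1 key => ->.
  by apply: maxUV; exact: unitaryM.
exists U, s, V; split=> //.
rewrite -e !mulmxA (unitaryC uU) mul1mx -mulmxA (unitaryC uV) mulmx1 //.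
Qed.

(** The trace inequality applied to [A] and [A] itself bounds both sums of
    squares by the mixed sum, so the sum of [(s l - s' l)^2] vanishes. *)
Lemma svd_unique A U s V U' s' V' :
  is_svd A U s V -> is_svd A U' s' V' -> s = s'.
Proof.
move=> svd1 svd2.
have h1 : \sum_l s 0 l * s 0 l <= \sum_l s 0 l * s' 0 l.
  apply: le_trans (von_neumann_trace svd1 svd2).
  by have [uU uV _ _ ->] := svd1; rewrite re_inner_svd.
have h2 : \sum_l s' 0 l * s' 0 l <= \sum_l s 0 l * s' 0 l.
  apply: le_trans (von_neumann_trace svd1 svd2).
  by have [uU uV _ _ ->] := svd2; rewrite re_inner_svd.
have h3 : \sum_l (s 0 l - s' 0 l) ^+ 2 <= 0.
  rewrite (eq_bigr (fun l => s 0 l * s 0 l + s' 0 l * s' 0 l -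
    (s 0 l * s' 0 l + s 0 l * s' 0 l))); last by move=> l _; ring.
  rewrite sumrB !big_split /=; lra.
apply/rowP => l; apply/eqP; rewrite -subr_eq0 -sqrf_eq0 eq_le sqr_ge0 andbT.
apply: le_trans h3; rewrite (bigD1 l) //= lerDl sumr_ge0 // => m _.
exact: sqr_ge0.
Qed.

Lemma singular_values_svd A U s V : is_svd A U s V -> singular_values A = s.
Proof.
move=> svdA; apply: xget_unique => [|s' [U' [V' svdA']]]; first by exists U, V.
exact: svd_unique svdA' svdA.
Qed.

Lemma sv_calculusP f A : exists U V, is_svd A U (singular_values A) V /\
  sv_calculus f A = U *m rect_diag k (map_mx f (singular_values A)) *m V^H.
Proof.
have [U [s [V svdA]]] := ex_svd A; rewrite /sv_calculus.
case: xgetP => [B _ [U' [V' [svdA' ->]]]|/(_ (U *m rect_diag k (map_mx f s) *m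
  V^H)) []].
  by exists U', V'.
by exists U, V; rewrite (singular_values_svd svdA).
Qed.

End SVD.

(** * Orthogonal projections *)

Section Projection.
Variables (R : realType) (k : scalar_kind) (M N : nat).
Local Notation K := (scalars R k).
Implicit Types X Y Z : 'M[K]_(M, N).

Lemma frob_inner_eq0C X Y : frob_inner X Y = 0 -> frob_inner Y X = 0.
Proof. by move=> h; rewrite frob_inner_conj h rmorph0. Qed.

Lemma frob_inner0r X : frob_inner X 0 = 0.
Proof.
by apply: frob_inner_eq0C; rewrite -[X in frob_inner X _](scale0r 0)
  frob_innerZl mul0r.
Qed.

(** Gram-Schmidt. If the orthogonalised vector [v'] vanishes, then so does [c],
    and the formula for the projection remains correct. *)
Lemma ex_proj_span (s : seq 'M[K]_(M, N)) X : exists2 Y, Y \in (span s) &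
  forall Z, Z \in (span s) -> frob_inner (X - Y) Z = 0.
Proof.
elim: s X => [|v s IHs] X.
  exists 0; first by rewrite mem0v.
  by move=> Z; rewrite span_nil memv0 => /eqP ->; exact: frob_inner0r.
have [p ps pP] := IHs v; have [Y0 Y0s Y0P] := IHs X.
set v' := v - p in pP; pose c := frob_inner X v' / frob_inner v' v'.
have sub Z : Z \in (span s) -> Z \in (span (v :: s)).
  by move=> Zs; rewrite span_cons -[Z]add0r memv_add // mem0v.
have vin : v \in (span (v :: s)) by rewrite memv_span // mem_head.
exists (Y0 + c *: v').
  by apply: memvD; [exact: sub|apply: memvZ; apply: memvB => //; exact: sub].
have orths Z : Z \in (span s) -> frob_inner (X - (Y0 + c *: v')) Z = 0.
  by move=> Zs; rewrite opprD addrA frob_innerBl Y0P // frob_innerZl pP // mulr0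
    subr0.
have orthv : frob_inner (X - (Y0 + c *: v')) v' = 0.
  rewrite opprD addrA !frob_innerBl frob_innerZl.
  rewrite (frob_inner_eq0C (pP _ Y0s)) subr0 /c.
  have [v0|n0] := eqVneq (frob_inner v' v') 0; last by rewrite divfK ?subrr.
  have -> : v' = 0 by apply: re_inner_eq0; rewrite /re_inner v0 raddf0.
  by rewrite !frob_inner0r mulr0 subr0.
move=> Z; rewrite span_cons => /memv_addP[_ /vlineP[a ->] [z zs ->]].
have -> : a *: v + z = a *: v' + (a *: p + z).
  by rewrite /v' scalerBr addrA subrK.
apply: frob_inner_eq0C; rewrite frob_innerDl frob_innerZl.
rewrite (frob_inner_eq0C orthv) mulr0 add0r; apply: frob_inner_eq0C.
by apply: orths; apply: memvD => //; apply: memvZ.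
Qed.

(** Two candidates differ by an element of [E] orthogonal to [E]. *)
Lemma orth_projE (E : set 'M[K]_(M, N)) X Y :
    (forall Z Z', E Z -> E Z' -> E (Z - Z')) ->
  E Y -> orth_compl E (X - Y) -> orth_proj E X = Y.
Proof.
move=> Esub EY XY; apply: xget_unique => // Z [EZ XZ].
apply/eqP; rewrite -subr_eq0; apply/eqP; apply: re_inner_eq0.
have EZY : E (Z - Y) by exact: Esub.
have e : Z - Y = (X - Y) - (X - Z) by rewrite opprB [RHS]addrC addrA subrK.
by rewrite /re_inner {1}e frob_innerBl XY // XZ // subrr raddf0.
Qed.

Lemma orth_compl_sub (E : set 'M[K]_(M, N)) X Y :
  orth_compl E X -> orth_compl E Y -> orth_compl E (X - Y).
Proof. by move=> hX hY Z EZ; rewrite frob_innerBl hX // hY // subrr. Qed.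

Variable H : {vspace 'M[K]_(M, N)}.
Let HS : set 'M[K]_(M, N) := [set X | X \in H].

Lemma orth_projP X : HS (orth_proj HS X) /\ orth_compl HS (X - orth_proj HS X).
Proof.
have [Y Ys YP] := ex_proj_span (vbasis H) X.
have eH : span (vbasis H) = H by apply: span_basis; exact: vbasisP.
rewrite eH in Ys YP.
rewrite (@orth_projE _ _ Y) // => Z Z'; exact: memvB.
Qed.

Lemma orth_proj_compl X :
  orth_proj (orth_compl HS) X = X - orth_proj HS X.
Proof.
have [PX QX] := orth_projP X.
apply: orth_projE => // [Z Z'|Y hY]; first exact: orth_compl_sub.
by rewrite subKr; apply: frob_inner_eq0C; apply: hY.
Qed.

End Projection.

(** * Picard iteration of an averaged map *)

Section Picard.
Variables (R : realType) (k : scalar_kind) (M N : nat).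
Local Notation K := (scalars R k).
Implicit Types X Y Z : 'M[K]_(M, N).

Lemma frob_normZ c X : 0 <= c -> frob_norm (of_real k c *: X) = c * frob_norm X.
Proof.
move=> c0; rewrite /frob_norm -!/(re_inner _ _) !re_innerE mulrA -expr2.
by rewrite sqrtrM ?sqr_ge0 // sqrtr_sqr ger0_norm.
Qed.

(** Bolzano-Weierstrass, from the compactness of a box of real coordinates. *)
Lemma bounded_cluster (W : nat -> 'M[K]_(M, N)) r :
    (forall n, re_inner (W n) (W n) <= r) ->
  exists Y, forall e, 0 < e -> forall m, exists2 n, (m <=
    n)%N & frob_norm (W n - Y) < e.
Proof.
move=> Wr; have r0 : 0 <= r := le_trans (re_inner_ge0 _) (Wr 0%N).
pose I : eqType := ('I_M * 'I_N)%type.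
pose T : topologicalType := prod_topology (fun _ : bool * I => R).
pose mx : T -> 'M[K]_(M, N) := mx_of_coords k id.
have cmx : mx_continuous mx by exact: mx_of_coords_continuous.
have /choice[f fP] : forall n, exists f : T, mx f = W n /\
    forall l, `[- Num.sqrt r, Num.sqrt r]%classic (f l).
  move=> n; have [f fP] := ex_coords (fun ij : I => W n ij.1 ij.2).
  exists f; split=> [|[b l]].
    by apply/matrixP => i j; rewrite mxE; have [<-] := fP (i, j).
  apply: sqr_le_box; first exact: sqrtr_ge0.
  rewrite sqr_sqrtr //; have [_ h] := fP l; apply: le_trans (h b) _.
  exact: le_trans (sqmod_le_re_inner _ _ _) (Wr n).
have fbox : (f n @[n --> \oo]) [set g : T | forall l, `[- Num.sqrt r, Num.sqrt
  r]%classic (g l)].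
  by exists 0%N => // n _; exact: (fP n).2.
have [p [_ clp]] := box_compact (fmap_proper_filter f _) fbox.
exists (mx p) => e e0 m; set Y := mx p.
have e4 : 0 < e ^+ 2 / 4 by rewrite divr_gt0 // exprn_gt0.
have n1 : \forall t \near p, `|re_inner Y Y - re_inner (mx t) (mx t)| < e ^+ 2 /
  4.
  exact: (@cvgr_dist_lt R R^o T (nbhs p) _ (fun t => re_inner (mx t) (mx t)) _
    (re_inner_continuous cmx cmx (x := p)) _ e4).
have n2 : \forall t \near p, `|re_inner Y Y - re_inner Y (mx t)| < e ^+ 2 / 4.
  exact: (@cvgr_dist_lt R R^o T (nbhs p) _ (fun t => re_inner Y (mx t)) _
    (re_inner_continuous (mx_continuous_cst (A := Y)) cmx (x := p)) _ e4).
have nm : (f n @[n --> \oo]) [set t | exists2 n, (m <= n)%N & f n = t].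
  by exists m => // n /= le_mn; exists n.
have [t [[n le_mn <-] [h1 h2]]] := clp _ _ nm (filterI n1 n2).
exists n => //.
(* [|W n - Y|^2] is the sum of three inner products, each close to [<Y, Y>]. *)
rewrite -(@ltr_pXn2r _ 2) ?nnegrE ?frob_norm_ge0 ?(ltW e0) // frob_norm_sqr.
move: h1 h2; rewrite /= (fP n).1 !re_innerE (re_innerC Y) !ltr_norml.
move=> /andP[h1 h1'] /andP[h2 h2']; lra.
Qed.

(** Existence of a fixed point is obtained together with the convergence. Let [y]
    be a cluster point of the orbit and [d] the limit of the nonincreasing step
    lengths. Every iterate of [y] is a cluster point of the orbit too, so all
    steps from [y] have length exactly [d], and then the averaging inequality
    forces them to be the same vector. The iterates of [y] would thus run along a
    line, which boundedness only allows if the step is [0]. Once [y] is fixed,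
    the distances to [y] are nonincreasing, and small along a subsequence. *)
Lemma averaged_picard (T : 'M[K]_(M, N) -> 'M[K]_(M, N)) (W :
  nat -> 'M[K]_(M, N)) r :
    (forall X Y, re_inner (T X - T Y) (T X - T Y) <= re_inner (X - Y) (X - Y) -
      re_inner ((X - Y) - (T X - T Y)) ((X - Y) - (T X - T Y)) / 2) ->
    (forall n, W n.+1 = T (W n)) -> (forall n, re_inner (W n) (W n) <= r) ->
  exists2 Y, T Y = Y & (fun n => frob_norm (W n - Y)) @ \oo --> (0 : R).
Proof.
move=> avgT WT Wr; have [y clW] := bounded_cluster Wr.
have nexp X Y : frob_norm (T X - T Y) <= frob_norm (X - Y).
  apply: frob_norm_le; apply: le_trans (avgT X Y) _.
  by rewrite gerBl divr_ge0 ?re_inner_ge0.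
pose a n := frob_norm (W n - W n.+1).
have a_anti m n : (m <= n)%N -> a n <= a m.
  elim: n => [|n IHn]; first by rewrite leqn0 => /eqP ->.
  rewrite leq_eqVlt => /orP[/eqP -> //|/IHn]; apply: le_trans.
  by rewrite /a !WT; apply: nexp.
have has_inf_a : has_inf (range a).
  split; first by exists (a 0%N); exists 0%N.
  by exists 0 => _ [n _ <-]; exact: frob_norm_ge0.
pose d := inf (range a).
have d_le n : d <= a n by apply: ge_inf; [exact: has_inf_a.2|exists n].
pose z m := iter m T y.
have Wz n m : frob_norm (W (n + m)%N - z m) <= frob_norm (W n - y).
  elim: m => [|m IHm]; first by rewrite addn0.
  by rewrite addnS WT /= (le_trans (nexp _ _)).
have zd m : frob_norm (z m - z m.+1) = d.
  apply/eqP; rewrite -subr_eq0 -normr_le0; apply/ler_addgt0Pr => e e0.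
  have e3 : 0 < e / 3 by rewrite divr_gt0.
  have [_ [n0 _ <-] an0] := inf_adherent e3 has_inf_a.
  have [n le_n Wn] := clW _ e3 n0.
  have h1 := Wz n m; have h2 := Wz n m.+1; rewrite addnS in h2.
  have h3 : a (n + m)%N < d + e / 3.
    by apply: le_lt_trans an0; apply: a_anti;
      rewrite (leq_trans le_n) // leq_addr.
  have h4 := d_le (n + m)%N.
  have h5 := frob_norm_dist (z m - z m.+1) (W (n + m)%N - W (n + m).+1).
  have h6 := frob_norm_triangle (- (W (n + m)%N - z m)) (W (n + m).+1 - z m.+1).
  have e6 : - (W (n + m)%N - z m) + (W (n + m).+1 - z m.+1) =
      z m - z m.+1 - (W (n + m)%N - W (n + m).+1).
    by apply/matrixP => i j; rewrite !mxE; ring.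
  rewrite e6 frob_normN in h6.
  move: h5 h3 h4; rewrite /a add0r !ler_norml => /andP[h5 h5'] h3 h4.
  apply/andP; split; lra.
have zstep m : z m - z m.+1 = y - T y.
  elim: m => [//|m IHm]; rewrite -IHm; apply/esym/eqP; rewrite -subr_eq0;
    apply/eqP.
  apply: re_inner_eq0; have := avgT (z m) (z m.+1).
  rewrite -[T (z m)]/(z m.+1) -[T (z m.+1)]/(z m.+2) -!frob_norm_sqr !zd; lra.
have zE m : z m = y - of_real k m%:R *: (y - T y).
  elim: m => [|m IHm]; first by rewrite mulr0n rmorph0 scale0r subr0.
  rewrite -[z m.+1](subKr (z m)) zstep IHm -addn1 natrD rmorphD scalerDl.
  by rewrite (rmorph1 (of_real k)) scale1r [in RHS]opprD addrA.
have Ty : T y = y.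
  (* The [m]-th iterate of [y] is within [1] of a point of the orbit. *)
  pose C := Num.sqrt r + 1 + frob_norm y.
  have C0 : 0 <= C by rewrite !addr_ge0 ?sqrtr_ge0 ?frob_norm_ge0.
  have bnd m : m%:R * frob_norm (y - T y) <= C.
    have [n _ Wn] := clW 1 ltr01 0%N.
    rewrite -frob_normZ ?ler0n //.
    have -> : of_real k m%:R *: (y - T y) = - z m + y by rewrite zE opprB subrK.
    have h1 := frob_norm_triangle (- z m) y; rewrite frob_normN in h1.
    have h2 := frob_norm_dist (W (n + m)%N) (z m).
    have h3 := Wz n m.
    have h4 : frob_norm (W (n + m)%N) <= Num.sqrt r
      by rewrite ler_wsqrtr // -/(re_inner _ _) Wr.
    move: h2; rewrite ler_norml => /andP[h2 _]; rewrite /C; lra.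
  apply/esym/eqP; rewrite -subr_eq0; apply/eqP; apply: re_inner_eq0.
  rewrite -frob_norm_sqr; set t := frob_norm _ in bnd *.
  have [->|t0] := eqVneq t 0; first by rewrite expr0n.
  have {}t0 : 0 < t by rewrite lt_def t0 frob_norm_ge0.
  have := bnd (Num.bound (C / t)); rewrite leNgt -ltr_pdivrMr //.
  by rewrite archi_boundP ?divr_ge0 ?(ltW t0).
exists y => //; apply/cvgrPdist_lt => e e0.
have [n0 _ Wn0] := clW e e0 0%N; exists n0 => // n /= le_n.
rewrite sub0r normrN ger0_norm ?frob_norm_ge0 //.
apply: le_lt_trans Wn0; rewrite -(subnKC le_n).
elim: (n - n0)%N => [|m IHm]; first by rewrite addn0.
by rewrite addnS WT -{1}Ty (le_trans (nexp _ _)).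
Qed.

End Picard.

(** * The scalar shrinkage function *)

Section Shrinkage.
Variables (R : realType) (tau q : R).
Local Notation s := (s_fun tau q).

(** The three branches of the function: identity, plateau, line of slope
    [1 / q]. In the last one the value is characterised by [q * s x = x] to keep
    divisions out of the polynomial arithmetic. *)
Lemma s_fun_cases (tau0 : 0 < tau) (q1 : 1 < q) (x : R) : 0 <= x ->
  [\/ [/\ x <= tau & s x = x], [/\ tau <= x, x <= q * tau & s x = tau] |
      [/\ q * tau <= x, tau <= x & q * s x = x]].
Proof.
move=> x0; have q0 : 0 < q by lra.
have xq : q * (x / q) = x by rewrite mulrCA divff ?mulr1 // gt_eqF.
rewrite /s_fun; set z := x / q in xq *.
have z0 : 0 <= z by rewrite divr_ge0 // ltW.
have zx : z <= x by rewrite -xq ler_peMl // ltW.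
case: (leP x tau) => h1.
  by constructor 1; split=> //; rewrite max_l.
case: (leP tau z) => h2; last by constructor 2; split; nra.
by constructor 3; split; nra.
Qed.

Lemma s_fun_ge0 (tau0 : 0 < tau) (q1 : 1 < q) x : 0 <= x -> 0 <= s x.
Proof. by move=> x0; case: (s_fun_cases tau0 q1 x0) => -[]; nra. Qed.

Lemma s_fun_le (tau0 : 0 < tau) (q1 : 1 < q) x : 0 <= x -> s x <= x.
Proof. by move=> x0; case: (s_fun_cases tau0 q1 x0) => -[]; nra. Qed.

Lemma s_fun_mono (tau0 : 0 < tau) (q1 : 1 < q) x y :
  0 <= x -> x <= y -> s x <= s y.
Proof.
move=> x0 xy; have y0 := le_trans x0 xy.
by case: (s_fun_cases tau0 q1 x0) => -[]; case: (s_fun_cases tau0 q1 y0) => -[];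
  nra.
Qed.

Lemma s_fun_residual_mono (tau0 : 0 < tau) (q1 : 1 < q) x y :
  0 <= x -> x <= y -> x - s x <= y - s y.
Proof.
move=> x0 xy; have y0 := le_trans x0 xy.
by case: (s_fun_cases tau0 q1 x0) => -[]; case: (s_fun_cases tau0 q1 y0) => -[];
  nra.
Qed.

(** This growth bound, with factor [1 / q < 1], is what keeps the orbits of the
    fixed point operator bounded. *)
Lemma s_fun_sqr (tau0 : 0 < tau) (q1 : 1 < q) x :
  0 <= x -> s x * s x <= tau ^+ 2 + x * x / q.
Proof.
move=> x0; have q0 : 0 < q by lra.
have h : 0 <= x * x / q by rewrite divr_ge0 ?mulr_ge0 // ltW.
case: (s_fun_cases tau0 q1 x0) => -[h1 h2].
- rewrite h2; nra.
- move=> ->; nra.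
move=> h3; rewrite -[in x * x](h3) in h *.
have -> : q * s x * (q * s x) / q = q * (s x * s x).
  by field; rewrite gt_eqF.
have := s_fun_ge0 tau0 q1 x0; nra.
Qed.

(** The function [b |-> (tau^2 - max (tau - b, 0)^2 + b^2) / 2] is convex on the
    half-line, linear of slope [tau] up to [tau] and then quadratic. The point
    [a = (y - s y) / (q - 1)] is chosen so that [s y] is a subgradient at [a]. *)
Lemma s_fun_subgradient (tau0 : 0 < tau) (q1 : 1 < q) y a b : 0 <= y -> 0 <= b ->
  (q - 1) * a = y - s y ->
  tau ^+ 2 - (Num.max (tau - a) 0) ^+ 2 + a * a - 2 * (s y * a) <=
  tau ^+ 2 - (Num.max (tau - b) 0) ^+ 2 + b * b - 2 * (s y * b).
Proof.
move=> y0 b0 ha; have q10 : 0 < q - 1 by lra.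
case: (s_fun_cases tau0 q1 y0) => -[].
- move=> h1 h2; have {ha} -> : a = 0.
    by apply: (mulfI (lt0r_neq0 q10)); rewrite ha h2 subrr mulr0.
  rewrite h2 subr0 max_l ?(ltW tau0) //.
  by case: (leP (tau - b) 0) => h; nra.
- move=> h1 h2 h3; rewrite h3 in ha *.
  have a0 : 0 <= a by rewrite -(pmulr_rge0 _ q10) ha; lra.
  have at_ : a <= tau by rewrite -(ler_pM2l q10) ha; lra.
  rewrite max_l ?subr_ge0 //.
  by case: (leP (tau - b) 0) => h; nra.
move=> h1 h2 h3; have as_ : a = s y.
  by apply: (mulfI (lt0r_neq0 q10)); rewrite ha; lra.
have at_ : tau <= a by rewrite as_ -(@ler_pM2l _ q) ?h3 //; lra.
rewrite -as_ max_r ?subr_le0 //.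
have := sqr_ge0 (a - b); case: (leP (tau - b) 0) => h; first by nra.
by have : 0 <= (a - tau) * (tau + a - 2 * b); [apply: mulr_ge0; lra|nra].
Qed.

End Shrinkage.

(** * The singular value calculus and the fixed point operator *)

Section Calculus.
Variables (R : realType) (k : scalar_kind) (M N : nat).
Local Notation K := (scalars R k).
Local Notation n := (minn M N).
Local Notation "A ^H" := (adjoint A) (at level 8, format "A ^H").
Implicit Types A B : 'M[K]_(M, N).

Lemma rect_diagB (s t : 'rV[R]_n) :
  rect_diag k (s - t) = rect_diag k s - rect_diag k t.
Proof.
rewrite !rect_diag_delta -sumrB; apply: eq_bigr => l _.
by rewrite !mxE rmorphB scalerBl.
Qed.

Lemma rect_diagZ a (s : 'rV[R]_n) :
  rect_diag k (a *: s) = of_real k a *: rect_diag k s.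
Proof.
rewrite !rect_diag_delta scaler_sumr; apply: eq_bigr => l _.
by rewrite !mxE rmorphM scalerA.
Qed.

(** If both [f] and [x - f x] are nonnegative and monotone, then [A], its image
    and the residual have decompositions with the same singular vectors and with
    singular values in the right order; this is what makes the trace inequality
    applicable to all of them. *)
Lemma sv_calculus_split f A :
    (forall x, 0 <= x -> 0 <= f x) -> (forall x, 0 <= x -> f x <= x) ->
    (forall x y, 0 <= x -> x <= y -> f x <= f y) ->
    (forall x y, 0 <= x -> x <= y -> x - f x <= y - f y) ->
  exists U V, let s := singular_values A in
    [/\ is_svd A U s V, is_svd (sv_calculus f A) U (map_mx f s) V
      & is_svd (A - sv_calculus f A) U (s - map_mx f s) V].
Proof.
move=> f0 fle fm rm; have [U [V [svdA ->]]] := sv_calculusP f A.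
exists U, V => s; split=> //; have [uU uV s0 as_ eA] := svdA.
  by split=> // [l|l m lm]; rewrite !mxE ?f0 // fm // as_.
split=> // [l|l m lm|].
- by rewrite !mxE subr_ge0 fle.
- by rewrite !mxE rm // as_.
by rewrite rect_diagB mulmxBr mulmxBl -eA.
Qed.

(** Firm nonexpansiveness. By the trace inequality, the inner product of the
    difference of the images with the difference of the residuals is at least
    the sum of the products
    [(f a_l - f b_l) * ((a_l - f a_l) - (b_l - f b_l))], whose factors never
    have opposite signs. *)
Lemma sv_calculus_firm f A B :
    (forall x, 0 <= x -> 0 <= f x) -> (forall x, 0 <= x -> f x <= x) ->
    (forall x y, 0 <= x -> x <= y -> f x <= f y) ->
    (forall x y, 0 <= x -> x <= y -> x - f x <= y - f y) ->
  re_inner (sv_calculus f A - sv_calculus f B) (sv_calculus f A - sv_calculus f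
    B) <=
  re_inner (sv_calculus f A - sv_calculus f B) (A - B).
Proof.
move=> f0 fle fm rm.
have [U [V [svdA svdSA svdRA]]] := sv_calculus_split A f0 fle fm rm.
have [U' [V' [svdB svdSB svdRB]]] := sv_calculus_split B f0 fle fm rm.
move: svdSA svdSB svdRA svdRB.
set SA := sv_calculus f A; set SB := sv_calculus f B.
set a := singular_values A in svdA *; set b := singular_values B in svdB *.
move=> svdSA svdSB svdRA svdRB.
have h1 := von_neumann_trace svdSA svdRB.
have h2 := von_neumann_trace svdSB svdRA.
have h3 : re_inner SA (A - SA) = \sum_l map_mx f a 0 l * (a - map_mx f a) 0 l.
  by have [uU uV _ _ ->] := svdRA; have [_ _ _ _ ->] := svdSA;
    rewrite re_inner_svd.
have h4 : re_inner SB (B - SB) = \sum_l map_mx f b 0 l * (b - map_mx f b) 0 l.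
  by have [uU uV _ _ ->] := svdRB; have [_ _ _ _ ->] := svdSB;
    rewrite re_inner_svd.
have [_ _ a0 _ _] := svdA; have [_ _ b0 _ _] := svdB.
have h5 : 0 <= \sum_l (f (a 0 l) - f (b 0 l)) *
    ((a 0 l - f (a 0 l)) - (b 0 l - f (b 0 l))).
  apply: sumr_ge0 => l _; case: (leP (a 0 l) (b 0 l)) => [ab|/ltW ba].
    by rewrite mulr_le0 // subr_le0 ?fm // rm.
  by rewrite mulr_ge0 // subr_ge0 ?fm // rm.
have h6 : \sum_l (f (a 0 l) - f (b 0 l)) *
    ((a 0 l - f (a 0 l)) - (b 0 l - f (b 0 l))) =
    re_inner SA (A - SA) + re_inner SB (B - SB) -
    (\sum_l map_mx f a 0 l * (b - map_mx f b) 0 l +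
     \sum_l map_mx f b 0 l * (a - map_mx f a) 0 l).
  rewrite h3 h4 -!big_split -sumrB /=; apply: eq_bigr => l _.
  by rewrite !mxE; ring.
rewrite h6 in h5; clearbody SA SB; move: h1 h2 h5;
  rewrite !re_innerE (re_innerC SB SA).
move: (re_inner SA SA) (re_inner SA SB) (re_inner SB SB) (re_inner SA A)
  (re_inner SA B) => u1 u2 u3 u4 u5.
move: (re_inner SB A) (re_inner SB B) (\sum_l _) (\sum_l _) => u6 u7 u8 u9; lra.
Qed.

End Calculus.

Section Main.
Variables (R : realType) (k : scalar_kind) (M N : nat).
Local Notation K := (scalars R k).
Local Notation n := (minn M N).
Local Notation "A ^H" := (adjoint A) (at level 8, format "A ^H").
Variables (H : {vspace 'M[K]_(M, N)}) (F : 'M[K]_(M, N)) (tau q : R).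
Local Notation HS := ([set X | X \in H] : set 'M[K]_(M, N)).
Local Notation P := (orth_proj HS).
Local Notation Q := (orth_proj (orth_compl HS)).
Local Notation T := (B_op HS F tau q).

Lemma re_inner_orth X Y : HS X -> orth_compl HS Y -> re_inner X Y = 0.
Proof. by move=> hX hY; rewrite re_innerC /re_inner hY // raddf0. Qed.

Lemma orth_compl_proj X : orth_compl HS (Q X).
Proof. by rewrite orth_proj_compl; have [] := orth_projP H X. Qed.

(** [T] is a firmly nonexpansive map after a translated orthogonal projection.
    Write [d], [u], [t] for the differences of the arguments, of their
    projections and of their images. Then [<t, t> <= <t, u>] and
    [<d - u, u> = 0], and the claim is that the square norm of
    [(d - u) - (u - t)] is nonnegative. *)
Lemma B_op_averaged (tau0 : 0 < tau) (q1 : 1 < q) X Y :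
  re_inner (T X - T Y) (T X - T Y) <= re_inner (X - Y) (X - Y) -
    re_inner ((X - Y) - (T X - T Y)) ((X - Y) - (T X - T Y)) / 2.
Proof.
have h : re_inner (T X - T Y) (T X - T Y) <= re_inner (T X - T Y) (Q X - Q Y).
  have -> : Q X - Q Y = (of_real k q *: F + Q X) - (of_real k q *: F + Q Y).
    by rewrite opprD addrACA subrr add0r.
  exact: (sv_calculus_firm _ _ (s_fun_ge0 tau0 q1) (s_fun_le tau0 q1)
    (s_fun_mono tau0 q1) (s_fun_residual_mono tau0 q1)).
have o : re_inner (P X - P Y) (Q X - Q Y) = 0.
  apply: re_inner_orth.
    by apply: memvB; have [] := orth_projP H X; have [] := orth_projP H Y.
  by apply: orth_compl_sub; exact: orth_compl_proj.
have e : P X - P Y = (X - Y) - (Q X - Q Y).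
  by rewrite !orth_proj_compl; apply/matrixP => i j; rewrite !mxE; ring.
rewrite e in o.
move: (T X - T Y) h => t; move: o; move: (X - Y) (Q X - Q Y) => d u o h.
have := re_inner_ge0 ((d - u) - (u - t)); move: o h.
rewrite !re_innerE (re_innerC u d) (re_innerC t d) (re_innerC t u); lra.
Qed.

Lemma B_op_bound (hF : F \in H) (tau0 : 0 < tau) (q1 : 1 < q) X :
  re_inner (T X) (T X) <= re_inner X X / q + (q * re_inner F F + n%:R * tau ^+ 2).
Proof.
have q0 : 0 < q := lt_trans ltr01 q1.
set Y := of_real k q *: F + Q X.
have YY : re_inner Y Y <= q ^+ 2 * re_inner F F + re_inner X X.
  have o1 : re_inner F (Q X) = 0 by apply: re_inner_orth => //;
    exact: orth_compl_proj.
  have o2 : re_inner (P X) (Q X) = 0.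
    by apply: re_inner_orth; [have [] := orth_projP H X|exact: orth_compl_proj].
  have -> : re_inner X X = re_inner (P X + Q X) (P X + Q X)
    by rewrite orth_proj_compl addrC subrK.
  have := re_inner_ge0 (P X); rewrite /Y !re_innerE (re_innerC (Q X)) o1
    (re_innerC (Q X)) o2; lra.
have [U [V [[uU uV a0 _ eY] svdS _]]] := sv_calculus_split Y (s_fun_ge0 tau0 q1)
  (s_fun_le tau0 q1) (s_fun_mono tau0 q1) (s_fun_residual_mono tau0 q1).
have -> : re_inner (T X) (T X) = \sum_l s_fun tau q (singular_values Y 0 l) *
    s_fun tau q (singular_values Y 0 l).
  rewrite /B_op -/Y; have [_ _ _ _ ->] := svdS; rewrite re_inner_svd //.
  by apply: eq_bigr => l _; rewrite !mxE.
have e : re_inner Y Y = \sum_l singular_values Y 0 l * singular_values Y 0 l.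
  by rewrite {1 2}eY re_inner_svd.
apply: (@le_trans _ _ (\sum_(l < n) (tau ^+ 2 + singular_values Y 0 l *
    singular_values Y 0 l / q))).
  by apply: ler_sum => l _; exact: s_fun_sqr.
rewrite big_split /= sumr_const card_ord -mulr_suml -e -mulr_natl.
have : re_inner Y Y / q <= (q ^+ 2 * re_inner F F + re_inner X X) / q
  by rewrite ler_pM2r ?invr_gt0.
have -> : (q ^+ 2 * re_inner F F + re_inner X X) / q = q * re_inner F F +
  re_inner X X / q.
  by field; rewrite gt_eqF.
lra.
Qed.

(** The square norms satisfy [w_{m+1} <= w_m / q + C]; the iterates of this
    affine contraction stay below [w_0] plus its fixed point
    [C * q / (q - 1)]. *)
Lemma B_op_orbit_bounded (hF : F \in H) (tau0 : 0 < tau) (q1 : 1 < q) W :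
  (forall m, W m.+1 = T (W m)) -> exists r, forall m, re_inner (W m) (W m) <= r.
Proof.
move=> WT; have q0 : 0 < q := lt_trans ltr01 q1.
pose C := q * re_inner F F + n%:R * tau ^+ 2.
have C0 : 0 <= C.
  by rewrite addr_ge0 // mulr_ge0 ?re_inner_ge0 ?ler0n ?sqr_ge0 // ltW.
have w0 := re_inner_ge0 (W 0%N).
pose r := re_inner (W 0%N) (W 0%N) + C * (q / (q - 1)).
have q10 : 0 < q - 1 by rewrite subr_gt0.
have D0 : 0 <= C * (q / (q - 1)) by rewrite mulr_ge0 // divr_ge0 ?ltW.
exists r; elim=> [|m IHm]; first by rewrite /r lerDl.
rewrite WT; apply: le_trans (B_op_bound hF tau0 q1 _) _; rewrite -/C.
have h : re_inner (W m) (W m) / q <= r / q by rewrite ler_pM2r ?invr_gt0.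
have e : r / q + C = re_inner (W 0%N) (W 0%N) / q + C * (q / (q - 1)).
  by rewrite /r; field; rewrite !gt_eqF.
have h2 : re_inner (W 0%N) (W 0%N) / q <= re_inner (W 0%N) (W 0%N).
  by rewrite ler_pdivrMr // ler_peMr // ltW.
apply: (@le_trans _ _ (r / q + C)); first by rewrite lerD2r.
by rewrite e /r lerD2r.
Qed.

Definition objective (A : 'M[K]_(M, N)) : R :=
  R_tau tau A + q * frob_norm (A - F) ^+ 2.

(** The point [A] is [(Y - S Y) / (q - 1)] for [Y = q F + Q W], so that
    [Y = W + (q - 1) A] with [W = S Y]. The singular values of [W] are
    subgradients at those of [A], and by the trace inequality [W] is a subgradient
    at [A] of half of [R_tau + |.|^2]. The remaining term [(q - 1) |.|^2] of the
    objective is quadratic and produces the strong growth, and for [B] in [H] the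
    matrix [Y] acts on [B - A] like [q F] because [Q W] is orthogonal to [H]. *)
Lemma fixed_point_growth (hF : F \in H) (tau0 : 0 < tau) (q1 : 1 < q) W :
  T W = W ->
  let A := of_real k (q - 1)^-1 *: (of_real k q *: F - P W) in
  HS A /\ forall B, HS B ->
    objective A + (q - 1) * re_inner (B - A) (B - A) <= objective B.
Proof.
move=> TW A; have q0 : 0 < q := lt_trans ltr01 q1.
have q10 : 0 < q - 1 by rewrite subr_gt0.
have [PW _] := orth_projP H W.
have hA : HS A by apply: memvZ; apply: memvB => //; exact: memvZ.
split=> // B hB.
pose Y := of_real k q *: F + Q W.
have AY : A = of_real k (q - 1)^-1 *: (Y - W).
  rewrite /A /Y orth_proj_compl; congr (_ *: _).
  by apply/matrixP => i j; rewrite !mxE; ring.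
have [U [V [[_ _ y0 _ _] svdS svdR]]] := sv_calculus_split Y (s_fun_ge0 tau0 q1)
  (s_fun_le tau0 q1) (s_fun_mono tau0 q1) (s_fun_residual_mono tau0 q1).
have SY : sv_calculus (s_fun tau q) Y = W by [].
rewrite SY in svdS svdR; set y := singular_values Y in y0 svdS svdR.
pose a : 'rV[R]_n := (q - 1)^-1 *: (y - map_mx (s_fun tau q) y).
have aE l : a 0 l = (q - 1)^-1 * (y - map_mx (s_fun tau q) y) 0 l by rewrite mxE.
have svdA : is_svd A U a V.
  have [uU uV r0 ar eR] := svdR; split=> //.
  - by move=> l; rewrite aE mulr_ge0 // invr_ge0 ltW.
  - by move=> l m lm; rewrite !aE ler_pM2l ?invr_gt0 //; exact: ar.
  by rewrite AY eR rect_diagZ -scalemxAr -scalemxAl.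
have [UB [b [VB svdB]]] := ex_svd B.
have [_ _ b0 _ _] := svdB.
have WB := von_neumann_trace svdS svdB.
have WA : re_inner W A = \sum_l map_mx (s_fun tau q) y 0 l * a 0 l.
  by have [uU uV _ _ ->] := svdS; have [_ _ _ _ ->] := svdA; rewrite re_inner_svd.
have AA : re_inner A A = \sum_l a 0 l * a 0 l.
  by have [uU uV _ _ ->] := svdA; rewrite re_inner_svd.
have BB : re_inner B B = \sum_l b 0 l * b 0 l.
  by have [uU uV _ _ ->] := svdB; rewrite re_inner_svd.
have RA : R_tau tau A = \sum_l (tau ^+ 2 - (Num.max (tau - a 0 l) 0) ^+ 2).
  by rewrite /R_tau (singular_values_svd svdA).
have RB : R_tau tau B = \sum_l (tau ^+ 2 - (Num.max (tau - b 0 l) 0) ^+ 2).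
  by rewrite /R_tau (singular_values_svd svdB).
have sub : R_tau tau A + re_inner A A - 2 * re_inner W A <=
  R_tau tau B + re_inner B B - 2 * re_inner W B.
  apply: (@le_trans _ _ (R_tau tau B + re_inner B B -
      2 * \sum_l map_mx (s_fun tau q) y 0 l * b 0 l)); last by lra.
  rewrite RA RB AA BB WA !mulr_sumr -!big_split /= -!sumrB.
  apply: ler_sum => l _; rewrite ![map_mx _ _ _ _]mxE.
  apply: s_fun_subgradient => //.
  by rewrite !mxE mulrA divff ?mul1r // gt_eqF.
have YE : Y = W + of_real k (q - 1) *: A.
  by rewrite AY scalerA -rmorphM divff ?gt_eqF // rmorph1 scale1r addrC subrK.
have orth : re_inner (B - A) (Q W) = 0.
  by apply: re_inner_orth; [exact: memvB|exact: orth_compl_proj].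
have QE : Q W = Y - of_real k q *: F by rewrite /Y addrC addKr.
clearbody A; move: orth; rewrite QE YE /objective !frob_norm_sqr; clear -sub.
move: sub; rewrite !re_innerE (re_innerC W A) (re_innerC W B) (re_innerC F A)
  (re_innerC F B) (re_innerC A B).
lra.
Qed.

End Main.

(** * Convergence and optimality *)

Theorem theorem5p1 (R : realType) (k : scalar_kind) (M N : nat)
    (H : {vspace 'M[scalars R k]_(M, N)}) (F : 'M[scalars R k]_(M, N))
    (tau q : R) (hF : F \in H) (htau : 0 < tau) (hq : 1 < q) :
  let HS : set 'M[scalars R k]_(M, N) := [set X | X \in H] in
  let B := B_op HS F tau q in
  [/\ (forall W : nat -> 'M[scalars R k]_(M, N),
        (forall n, W n.+1 = B (W n)) ->
        exists2 Wo, B Wo = Wo &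
          (fun n => frob_norm (W n - Wo)) @ \oo --> (0 : R)),
      (forall W1 W2, B W1 = W1 -> B W2 = W2 ->
        orth_proj HS W1 = orth_proj HS W2)
    & (forall Wo, B Wo = Wo ->
        argmin HS (fun A => R_tau tau A + q * frob_norm (A - F) ^+ 2) =
        [set of_real k (q - 1)^-1 *: (of_real k q *: F - orth_proj HS Wo)])].
Proof.
move=> HS B; have q10 : 0 < q - 1 by rewrite subr_gt0.
have argminE Wo : B Wo = Wo ->
    argmin HS (fun A => R_tau tau A + q * frob_norm (A - F) ^+ 2) =
    [set of_real k (q - 1)^-1 *: (of_real k q *: F - orth_proj HS Wo)].
  move=> /(fixed_point_growth hF htau hq)[].
  set A := _ *: _ => hA growA; apply/seteqP; split=> [X [hX minX]|_ ->] /=.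
    apply/eqP; rewrite -subr_eq0; apply/eqP; apply: re_inner_eq0.
    rewrite -(pmulr_rle0 _ q10) -(gerDl (objective F tau q A)).
    exact: le_trans (growA X hX) (minX A hA).
  split=> // X hX; apply: le_trans (growA X hX).
  by rewrite lerDl mulr_ge0 ?re_inner_ge0 // ltW.
split=> // [W WB|W1 W2 fix1 fix2].
  have [r Wr] := B_op_orbit_bounded hF htau hq WB.
  exact: averaged_picard (B_op_averaged H F htau hq) WB Wr.
have : [set of_real k (q - 1)^-1 *: (of_real k q *: F - orth_proj HS W2)]
    (of_real k (q - 1)^-1 *: (of_real k q *: F - orth_proj HS W1)).
  by rewrite -(argminE _ fix2) (argminE _ fix1).
move/(scalerI _); rewrite fmorph_eq0 invr_eq0 gt_eqF // => /(_ isT).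
by move/addrI/oppr_inj.
Qed.
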